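(* Let $V$ be a normal matrix ordered $*$-operator space. Then there exist a Hilbert space $H$ and a linear map $\phi:V\to B(H)$ which is a completely isometric complete order embedding: for all $n,m\in\mathbb{N}$ and $A\in M_{n,m}(V)$, $\|\phi^{(n,m)}(A)\|_{B(H^m,H^n)}=\|A\|_{n,m}$, and for all $n$ and $A\in M_n(V)$, $\phi^{(n)}(A)\ge0$ in $M_n(B(H))$ if and only if $A\in M_n(V)_+$.
   Context: A $*$-vector space is a complex vector space with a conjugate-linear involution $x\mapsto x^*$; $M_{n,m}(V)$ gets the involution $(x_{ij})^*=(x_{ji}^* )\in M_{m,n}(V)$ and $M_n(V)_{sa}$ denotes the self-adjoint elements of $M_n(V)$. An (abstract) operator space is a complex vector space $V$ with norms $\|\cdot\|_{n,m}$ on $M_{n,m}(V)$ such that $\|XAY\|_{k,l}\le\|X\|\|A\|_{n,m}\|Y\|$ for scalar $X\in M_{k,n}$, $Y\in M_{m,l}$, and $\|A\oplus B\|=\max\{\|A\|,\|B\|\}$. A $*$-operator space is an operator space which is a $*$-vector space with $\|A^*\|_{m,n}=\|A\|_{n,m}$. It is matrix ordered if for each $n$ there is a proper cone $M_n(V)_+\subseteq M_n(V)_{sa}$ such that $A\in M_n(V)_+$, $B\in M_k(V)_+$, $X\in M_{l,k}$ imply $A\oplus B\in M_{n+k}(V)_+$ and $XBX^*\in M_l(V)_+$. It is normal if for every $n$, $(M_n(V)_{sa},\|\cdot\|_{n,n},M_n(V)_+)$ is a normal ordered vector space, i.e. $M_n(V)_+$ is norm closed and $A\le B\le C$ implies $\|B\|\le\max\{\|A\|,\|C\|\}$.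 $\phi^{(n,m)}(a_{ij})=(\phi(a_{ij}))$ and $\phi^{(n)}=\phi^{(n,n)}$; $M_{n,m}(B(H))$ is identified with $B(H^m,H^n)$. *)

(* Defs.v *)
From Stdlib Require Import Reals.
From mathcomp Require Import all_boot.

Set Implicit Arguments.
Unset Strict Implicit.
Unset Printing Implicit Defensive.

Local Open Scope R_scope.

Record C := mkC { Cre : R; Cim : R }.
Definition C0 : C := mkC 0 0.
Definition C1 : C := mkC 1 0.
Definition RtoC (r : R) : C := mkC r 0.
Definition Cadd (a b : C) : C := mkC (Cre a + Cre b) (Cim a + Cim b).
Definition Copp (a : C) : C := mkC (- Cre a) (- Cim a).
Definition Cmul (a b : C) : C :=
  mkC (Cre a * Cre b - Cim a * Cim b) (Cre a * Cim b + Cim a * Cre b).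
Definition Cconj (a : C) : C := mkC (Cre a) (- Cim a).
Definition Cabs2 (a : C) : R := Cre a * Cre a + Cim a * Cim a.
Definition Cabs (a : C) : R := sqrt (Cabs2 a).

Record CVSpace := {
  cvs_car :> Type;
  vzero : cvs_car;
  vadd : cvs_car -> cvs_car -> cvs_car;
  vopp : cvs_car -> cvs_car;
  vscale : C -> cvs_car -> cvs_car;
  vaddA : forall x y z, vadd x (vadd y z) = vadd (vadd x y) z;
  vaddC : forall x y, vadd x y = vadd y x;
  vadd0 : forall x, vadd x vzero = x;
  vaddN : forall x, vadd x (vopp x) = vzero;
  vscale1 : forall x, vscale C1 x = x;
  vscaleA : forall a b x, vscale a (vscale b x) = vscale (Cmul a b) x;
  vscaleDl : forall a b x, vscale (Cadd a b) x = vadd (vscale a x) (vscale b x);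
  vscaleDr : forall a x y, vscale a (vadd x y) = vadd (vscale a x) (vscale a y)
}.
Arguments vzero {c}.
Arguments vadd {c}.
Arguments vopp {c}.
Arguments vscale {c}.

Definition vsub (V : CVSpace) (x y : V) : V := vadd x (vopp y).

Definition vsum (V : CVSpace) (n : nat) (F : 'I_n -> V) : V :=
  \big[@vadd V/vzero]_(i < n) F i.
Definition Rsum (n : nat) (F : 'I_n -> R) : R := \big[Rplus/0]_(i < n) F i.
Definition Csum (n : nat) (F : 'I_n -> C) : C := \big[Cadd/C0]_(i < n) F i.

Definition ipnorm (V : CVSpace) (ip : V -> V -> C) (x : V) : R := sqrt (Cre (ip x x)).

Record HilbertSpace := {
  hs_vs :> CVSpace;
  ip : hs_vs -> hs_vs -> C;
  ip_addl : forall x y z, ip (vadd x y) z = Cadd (ip x z) (ip y z);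
  ip_scalel : forall a x y, ip (vscale a x) y = Cmul a (ip x y);
  ip_conj : forall x y, ip y x = Cconj (ip x y);
  ip_pos : forall x, 0 <= Cre (ip x x);
  ip_def : forall x, ip x x = C0 -> x = vzero;
  hs_complete : forall u : nat -> hs_vs,
    (forall eps, 0 < eps -> exists N, forall p q, (N <= p)%N -> (N <= q)%N ->
        ipnorm ip (vsub (u p) (u q)) < eps) ->
    exists l, forall eps, 0 < eps -> exists N, forall p, (N <= p)%N ->
        ipnorm ip (vsub (u p) l) < eps
}.
Arguments ip {h}.

Definition hnorm (H : HilbertSpace) (x : H) : R := ipnorm (@ip H) x.

Definition bounded_linear (H : HilbertSpace) (T : H -> H) : Prop :=
  (forall x y, T (vadd x y) = vadd (T x) (T y)) /\
  (forall a x, T (vscale a x) = vscale a (T x)) /\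
  (exists c, forall x, hnorm (T x) <= c * hnorm x).

Definition hvnorm (H : HilbertSpace) (n : nat) (x : 'I_n -> H) : R :=
  sqrt (Rsum (fun j => Cre (ip (x j) (x j)))).
Definition hvip (H : HilbertSpace) (n : nat) (x y : 'I_n -> H) : C :=
  Csum (fun j => ip (x j) (y j)).

Definition op_pos (H : HilbertSpace) (n : nat) (T : ('I_n -> H) -> ('I_n -> H)) : Prop :=
  forall x, Cim (hvip (T x) x) = 0 /\ 0 <= Cre (hvip (T x) x).

Definition Mat (T : Type) (n m : nat) := 'I_n -> 'I_m -> T.

Section MatOps.
Variable V : CVSpace.

Definition mzero n m : Mat V n m := fun _ _ => vzero.
Definition madd n m (A B : Mat V n m) : Mat V n m := fun i j => vadd (A i j) (B i j).
Definition mopp n m (A : Mat V n m) : Mat V n m := fun i j => vopp (A i j).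
Definition msub n m (A B : Mat V n m) : Mat V n m := madd A (mopp B).
Definition mscale n m (a : C) (A : Mat V n m) : Mat V n m := fun i j => vscale a (A i j).
Definition mstar (star : V -> V) n m (A : Mat V n m) : Mat V m n :=
  fun i j => star (A j i).

Definition smul k n m l (X : Mat C k n) (A : Mat V n m) (Y : Mat C m l) : Mat V k l :=
  fun i j => vsum (fun p => vsum (fun q => vscale (Cmul (X i p) (Y q j)) (A p q))).

Definition dsum n m k l (A : Mat V n m) (B : Mat V k l) : Mat V (n + k) (m + l) :=
  fun i j => match split i, split j with
             | inl i', inl j' => A i' j'
             | inr i', inr j' => B i' j'
             | _, _ => vzero
             end.
End MatOps.

Definition cadj k l (X : Mat C k l) : Mat C l k := fun i j => Cconj (X j i).

Definition cvnorm n (v : 'I_n -> C) : R := sqrt (Rsum (fun i => Cabs2 (v i))).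
Definition cmatvec k n (X : Mat C k n) (v : 'I_n -> C) : 'I_k -> C :=
  fun i => Csum (fun p => Cmul (X i p) (v p)).
Definition is_cmat_opnorm k n (X : Mat C k n) (c : R) : Prop :=
  is_lub (fun r => exists v, cvnorm v <= 1 /\ r = cvnorm (cmatvec X v)) c.

Section OpSpaceDefs.
Variable V : CVSpace.
Variable star : V -> V.
Variable nrm : forall {n m : nat}, Mat V n m -> R.
Variable cone : forall {n : nat}, Mat V n n -> Prop.

Definition star_vector_space : Prop :=
  (forall x, star (star x) = x) /\
  (forall x y, star (vadd x y) = vadd (star x) (star y)) /\
  (forall a x, star (vscale a x) = vscale (Cconj a) (star x)).

Definition matrix_norms : Prop :=
  forall n m,
    (forall A : Mat V n m, 0 <= nrm A) /\
    (forall A : Mat V n m, nrm A = 0 -> A = @mzero V n m) /\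
    (forall a (A : Mat V n m), nrm (mscale a A) = Cabs a * nrm A) /\
    (forall A B : Mat V n m, nrm (madd A B) <= nrm A + nrm B).

Definition ruan_conditions : Prop :=
  (forall k n m l (X : Mat C k n) (A : Mat V n m) (Y : Mat C m l) cX cY,
      is_cmat_opnorm X cX -> is_cmat_opnorm Y cY ->
      nrm (smul X A Y) <= cX * nrm A * cY) /\
  (forall n m k l (A : Mat V n m) (B : Mat V k l),
      nrm (dsum A B) = Rmax (nrm A) (nrm B)).

Definition star_isometric : Prop :=
  forall n m (A : Mat V n m), nrm (mstar star A) = nrm A.

Definition self_adjoint n (A : Mat V n n) : Prop := mstar star A = A.

Definition proper_cones : Prop :=
  forall n,
    (forall A : Mat V n n, cone A -> self_adjoint A) /\
    cone (@mzero V n n) /\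
    (forall A B : Mat V n n, cone A -> cone B -> cone (madd A B)) /\
    (forall (t : R) (A : Mat V n n), 0 <= t -> cone A -> cone (mscale (RtoC t) A)) /\
    (forall A : Mat V n n, cone A -> cone (mopp A) -> A = @mzero V n n).

Definition matrix_ordered : Prop :=
  proper_cones /\
  (forall n k (A : Mat V n n) (B : Mat V k k), cone A -> cone B -> cone (dsum A B)) /\
  (forall l k (X : Mat C l k) (B : Mat V k k), cone B -> cone (smul X B (cadj X))).

Definition normal_order : Prop :=
  forall n,
    (forall (u : nat -> Mat V n n) (A : Mat V n n),
        (forall p, cone (u p)) ->
        (forall eps, 0 < eps -> exists N, forall p, (N <= p)%N -> nrm (msub A (u p)) < eps) ->
        cone A) /\
    (forall A B D : Mat V n n,
        self_adjoint A -> self_adjoint B -> self_adjoint D ->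
        cone (msub B A) -> cone (msub D B) ->
        nrm B <= Rmax (nrm A) (nrm D)).
End OpSpaceDefs.

Record NormalMOStarOpSpace := {
  nv :> CVSpace;
  vstar : nv -> nv;
  mnorm : forall n m, Mat nv n m -> R;
  mcone : forall n, Mat nv n n -> Prop;
  nv_star : star_vector_space vstar;
  nv_norms : matrix_norms mnorm;
  nv_ruan : ruan_conditions mnorm;
  nv_star_isom : star_isometric vstar mnorm;
  nv_ordered : matrix_ordered vstar mcone;
  nv_normal : normal_order vstar mnorm mcone
}.
Arguments mnorm {n0} {n m}.
Arguments mcone {n0} {n}.

Definition ampl (V : CVSpace) (H : HilbertSpace) (phi : V -> H -> H)
  n m (A : Mat V n m) (x : 'I_m -> H) : 'I_n -> H :=
  fun i => vsum (fun j => phi (A i j) (x j)).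

Definition is_ampl_opnorm (V : CVSpace) (H : HilbertSpace) (phi : V -> H -> H)
  n m (A : Mat V n m) (c : R) : Prop :=
  is_lub (fun r => exists x : 'I_m -> H, hvnorm x <= 1 /\ r = hvnorm (ampl phi A x)) c.

(* Main.v *)
(** Call a linear, *-preserving, completely positive, completely contractive
    map from V into matrices a block.  The Hilbert space is the l2-sum of the
    spaces C^K over all blocks, and V acts diagonally; it remains to show that
    blocks detect the norm and the cone.

    For A self-adjoint in M_N(V) and c > 0, suppose A is not of the form Q + P
    with |Q| <= c and P positive.  In M_N(V) x M_N(C) consider the cone of
    pairs (A', q) such that A' + A'^* = X^*BY + (X^*BY)^* + P' and
    X^*X + Y^*Y <= 2 Re q, with |B| <= 1 and P' positive.  It has the order
    unit (0, 1) and does not contain (A, c 1), so by Krein's theorem a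
    functional F is nonnegative on it, with F(0, 1) = 1 and F(A, c 1) <= 0.
    Its second component is a positive semidefinite form p on C^N, its first
    one a V-indexed family of sesquilinear forms dominated by p.  A
    p-orthonormal family turns these into a block psi together with a vector e,
    |e| <= 1, such that <psi(A) e, e> <= -c.  Closedness of the cone then yields
    the order embedding.  Normality yields the norm of self-adjoint A, since
    Q1 <= A <= -Q2 forces |A| <= max(|Q1|, |Q2|), and passing to
    [[0, A], [A^*, 0]] handles rectangular A. *)

From Stdlib Require Import Reals Lra.
From HB Require Import structures.
From mathcomp Require Import all_boot.
From mathcomp Require Import boolp classical_sets.
Require Import Defs.

Set Implicit Arguments.
Unset Strict Implicit.
Unset Printing Implicit Defensive.

Local Open Scope R_scope.

Declare Scope C_scope.
Delimit Scope C_scope with C.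
Bind Scope C_scope with C.

(** A functional on M_N(V) alone would give a family of forms but no scalar form dominating it;
    finding one afterwards would take a second separation. The component in M_N(C) avoids this: the
    cone records each factorisation X^*BY together with its cost (X^*X + Y^*Y)/2, so one functional
    carries both the forms and the form that dominates them. It also supplies the order unit, which
    the cone of M_N(V) need not have. Since X and Y may have any number of rows, nonnegativity on
    this single cone already contains the estimates for all matrix sizes. The conditions are put on
    A' + A'^* and on Re q, so the pairs range over a full complex vector space, and the hermitian
    symmetry of F follows from nonnegativity. Contractivity is carried in the form 2 Re g <= |B| (p
    + p), because this is linear in the values of F; rescaling one argument recovers the sharp
    bound. As p lives on C^N, an orthonormal family for it is finite: every block is matrix-valued,
    and only the l2-sum needs a completeness proof. *)

Definition Csub (a b : C) : C := Cadd a (Copp b).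

Local Infix "+" := Cadd : C_scope.
Local Infix "-" := Csub : C_scope.
Local Infix "*" := Cmul : C_scope.
Local Notation "- a" := (Copp a) : C_scope.
Local Notation "0" := C0 : C_scope.
Local Notation "1" := C1 : C_scope.
Local Infix "+v" := vadd (at level 50, left associativity).
Local Infix "*v" := vscale (at level 40, left associativity).
Local Notation "-v x" := (vopp x) (at level 35, right associativity).
Local Notation "0v" := vzero.
Local Notation Ci := (mkC R0 R1).

Local Notation "t *r x" := (vscale (RtoC t) x) (at level 40, left associativity).
Local Notation "\csum_ i F" := (\big[Cadd/C0]_i F%C)
  (at level 41, i at level 0, F at level 41, right associativity).
Local Notation "\rsum_ i F" := (\big[Rplus/R0]_i F)
  (at level 41, i at level 0, F at level 41, right associativity).
Local Notation "\vsum_ i F" := (\big[vadd/0v]_i F)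
  (at level 41, i at level 0, F at level 41, right associativity).
Local Notation "\csum_ ( i < n ) F" := (\big[Cadd/C0]_(i < n) F%C)
  (at level 41, i, n at level 50, F at level 41, right associativity).
Local Notation "\rsum_ ( i < n ) F" := (\big[Rplus/R0]_(i < n) F)
  (at level 41, i, n at level 50, F at level 41, right associativity).
Local Notation "\vsum_ ( i < n ) F" := (\big[vadd/0v]_(i < n) F)
  (at level 41, i, n at level 50, F at level 41, right associativity).

(** * Complex arithmetic and linear identities in vector spaces *)

Lemma C_ext (a b : C) : Cre a = Cre b -> Cim a = Cim b -> a = b.
Proof. by case: a b => ? ? [? ?] /= -> ->. Qed.

Ltac ceq := apply: C_ext; rewrite /=; first [ring | field; lra | lra].

Lemma C_ring_theory : ring_theory C0 C1 Cadd Cmul Csub Copp eq.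
Proof. by split=> *; ceq. Qed.
Add Ring C_ring : C_ring_theory.

Lemma CaddA : associative Cadd. Proof. by move=> *; ring. Qed.
Lemma CaddC : commutative Cadd. Proof. by move=> *; ring. Qed.
Lemma Cadd0l : left_id C0 Cadd. Proof. by move=> *; ring. Qed.
HB.instance Definition _ := Monoid.isComLaw.Build C C0 Cadd CaddA CaddC Cadd0l.

Lemma RplusA : associative Rplus. Proof. by move=> *; ring. Qed.
Lemma RplusC : commutative Rplus. Proof. by move=> *; ring. Qed.
Lemma Rplus0l : left_id 0 Rplus. Proof. by move=> *; ring. Qed.
HB.instance Definition _ := Monoid.isComLaw.Build R 0 Rplus RplusA RplusC Rplus0l.

Lemma vadd0l (V : CVSpace) : left_id vzero (@vadd V).
Proof. by move=> x; rewrite vaddC vadd0. Qed.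
HB.instance Definition _ (V : CVSpace) :=
  Monoid.isComLaw.Build V vzero (@vadd V) (@vaddA V) (@vaddC V) (@vadd0l V).

Lemma Cconj_add a b : Cconj (a + b) = (Cconj a + Cconj b)%C. Proof. ceq. Qed.
Lemma Cconj_mul a b : Cconj (a * b) = (Cconj a * Cconj b)%C. Proof. ceq. Qed.
Lemma CconjK a : Cconj (Cconj a) = a. Proof. ceq. Qed.
Lemma Cconj_RtoC r : Cconj (RtoC r) = RtoC r. Proof. ceq. Qed.
Lemma Cabs2_ge0 a : 0 <= Cabs2 a. Proof. rewrite /Cabs2; nra. Qed.
Lemma Cabs2_eq0 a : Cabs2 a = 0 -> a = C0.
Proof. rewrite /Cabs2 => h; apply: C_ext => /=; nra. Qed.
Lemma Cabs2_mul a b : Cabs2 (a * b) = Cabs2 a * Cabs2 b.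
Proof. rewrite /Cabs2 /=; ring. Qed.
Lemma Cabs_RtoC t : 0 <= t -> Cabs (RtoC t) = t.
Proof.
by move=> t0; rewrite /Cabs /Cabs2 /= Rmult_0_l Rplus_0_r sqrt_square.
Qed.

Section Module.
Variable V : CVSpace.
Implicit Types x y z : V.

Lemma vaddKl x y z : x +v y = x +v z -> y = z.
Proof.
move=> h; rewrite -(vadd0l y) -(vadd0l z) -(vaddN x) [x +v _]vaddC.
by rewrite -!vaddA h.
Qed.

Lemma vscale0 x : C0 *v x = 0v.
Proof.
apply: (@vaddKl (C0 *v x)); rewrite -vscaleDl vadd0.
by congr vscale; ring.
Qed.

Lemma vscaler0 a : a *v (0v : V) = 0v.
Proof. by apply: (@vaddKl (a *v 0v)); rewrite -vscaleDr !vadd0. Qed.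

Lemma voppE x : -v x = (- (1))%C *v x.
Proof.
apply: (@vaddKl x); rewrite vaddN -{1}(vscale1 x) -vscaleDl.
by rewrite (_ : (1 + - (1))%C = C0) ?vscale0 //; ring.
Qed.

(* Syntax of the reflective tactic [vlin], which proves an identity between
   linear combinations by comparing the coefficients of each atom. *)
Inductive lexp :=
  | LAtom of nat | LZero | LAdd of lexp & lexp | LOpp of lexp
  | LScale of C & lexp.

Fixpoint leval (env : seq V) e : V :=
  match e with
  | LAtom n => nth 0v env n
  | LZero => 0v
  | LAdd a b => leval env a +v leval env b
  | LOpp a => -v leval env a
  | LScale c a => c *v leval env a
  end.

Fixpoint lcoef e (n : nat) : C :=
  match e with
  | LAtom m => if Nat.eqb m n then C1 else C0
  | LZero => C0
  | LAdd a b => (lcoef a n + lcoef b n)%C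
  | LOpp a => (- lcoef a n)%C
  | LScale c a => (c * lcoef a n)%C
  end.

Lemma leval_coef env e :
  leval env e = \big[@vadd V/0v]_(i < size env) (lcoef e i *v nth 0v env i).
Proof.
elim: e => [n||a IHa b IHb|a IHa|c a IHa] /=.
- have [nlt|nge] := ltnP n (size env).
    rewrite (bigD1 (Ordinal nlt)) //= PeanoNat.Nat.eqb_refl vscale1 big1 ?vadd0 // => i.
    rewrite -val_eqE eq_sym /= => /eqP/PeanoNat.Nat.eqb_neq ->.
    by rewrite vscale0.
  rewrite nth_default // big1 // => i _.
  have /PeanoNat.Nat.eqb_neq -> : n <> i.
    by move=> ni; move: nge; rewrite ni leqNgt ltn_ord.
  by rewrite vscale0.
- by rewrite big1 // => i _; rewrite vscale0.
- by rewrite IHa IHb -big_split; apply: eq_bigr => i _; rewrite vscaleDl.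
- rewrite IHa voppE (@big_morph _ _ _ 0v (@vadd V) 0v (@vadd V)) ?vscaler0 //.
    apply: eq_bigr => i _; rewrite vscaleA; congr vscale; ring.
  by move=> x y; rewrite vscaleDr.
- rewrite IHa (@big_morph _ _ _ 0v (@vadd V) 0v (@vadd V)) ?vscaler0 //.
    by apply: eq_bigr => i _; rewrite vscaleA.
  by move=> x y; rewrite vscaleDr.
Qed.

(** Recursion on [n] lets [/=] unfold this, for a concrete environment, into a finite conjunction of
    scalar identities, one for each atom. *)
Fixpoint lcoef_eq e e' n : Prop :=
  if n is n'.+1 then lcoef e n' = lcoef e' n' /\ lcoef_eq e e' n' else True.

Lemma leval_eq env e e' :
  lcoef_eq e e' (size env) -> leval env e = leval env e'.
Proof.
move=> h; rewrite !leval_coef; apply: eq_bigr => i _; congr vscale.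
elim: (size env) (nat_of_ord i) (ltn_ord i) h => //= n IH k.
by rewrite ltnS leq_eqVlt => /orP[/eqP -> []|lt [_ /IH]] //; apply.
Qed.
End Module.

Ltac vfind x env :=
  lazymatch env with
  | x :: _ => constr:(O)
  | _ :: ?e => let n := vfind x e in constr:(S n)
  end.
Ltac vmem x env :=
  lazymatch env with
  | x :: _ => constr:(true)
  | _ :: ?e => vmem x e
  | _ => constr:(false)
  end.
Ltac vatoms t env :=
  lazymatch t with
  | vadd ?a ?b => let e := vatoms a env in vatoms b e
  | vopp ?a => vatoms a env
  | vscale _ ?a => vatoms a env
  | vzero => env
  | _ => lazymatch vmem t env with
         | true => env
         | _ => constr:(t :: env)
         end
  end.
Ltac vreify t env :=
  lazymatch t with
  | vadd ?a ?b => let a' := vreify a env in let b' := vreify b env in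
                  constr:(LAdd a' b')
  | vopp ?a => let a' := vreify a env in constr:(LOpp a')
  | vscale ?c ?a => let a' := vreify a env in constr:(LScale c a')
  | vzero => constr:(LZero)
  | _ => let n := vfind t env in constr:(LAtom n)
  end.
Ltac vlin_core :=
  rewrite /vsub;
  lazymatch goal with
  | |- @eq ?T ?l ?r =>
    let V := lazymatch T with cvs_car ?V => V end in
    let env := vatoms l (@nil T) in
    let env := vatoms r env in
    let l' := vreify l env in
    let r' := vreify r env in
    apply: (@leval_eq V env l' r')
  end; rewrite /=.
Ltac vlin :=
  vlin_core; repeat split; first [ring | ceq].

Lemma vscaleDr_sum (V : CVSpace) I (r : seq I) (P : pred I) a (F : I -> V) :
  a *v (\big[@vadd V/0v]_(i <- r | P i) F i)
  = \big[@vadd V/0v]_(i <- r | P i) (a *v F i).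
Proof.
by apply: big_morph => [x y|]; [exact: vscaleDr | exact: vscaler0].
Qed.

(** * Separation from a cone with an order unit *)

Section Krein.
Variables (E : CVSpace) (K : E -> Prop) (u a0 : E).
Hypothesis KD : forall x y, K x -> K y -> K (x +v y).
Hypothesis KZ : forall t x, 0 <= t -> K x -> K (t *r x).
Hypothesis Ku : K u.
Hypothesis K_absorbing : forall a, exists t, K (a +v t *r u).
Hypothesis Ka0 : ~ K a0.

Let K0 x := exists k s, K k /\ 0 <= s /\ x = k +v (- s) *r a0.

(** [K0] is only required to be absorbed by [M], not to lie in it: [Zorn_bigcup] also ranges over
    the empty chain, whose union is empty. That the maximal [M] contains [K0] is proved
    afterwards. *)
Let good (M : set E) :=
  [/\ forall x y, M x -> M y -> M (x +v y),
      forall t x, 0 < t -> M x -> M (t *r x),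
      forall x y, K0 x -> M y -> M (x +v y) & ~ M (-v u)].

Let K0D x y : K0 x -> K0 y -> K0 (x +v y).
Proof.
move=> [k [s [Kk [s0 ->]]]] [k' [s' [Kk' [s0' ->]]]].
exists (k +v k'), (s + s'); split; [exact: KD | split; [lra | vlin]].
Qed.

Let K0Z t x : 0 <= t -> K0 x -> K0 (t *r x).
Proof.
move=> t0 [k [s [Kk [s0 ->]]]].
exists (t *r k), (t * s); split; [exact: KZ | split; [nra | vlin]].
Qed.

Let KK0 x : K x -> K0 x.
Proof. by move=> Kx; exists x, 0; split=> //; split; [lra | vlin]. Qed.

(** If -u = k - s a0 with s > 0, then a0 = (k + u)/s lies in [K]. If s = 0, then [K] contains the
    order unit and its opposite, hence everything, including a0. *)
Let K0u : ~ K0 (-v u).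
Proof.
have KNu : ~ K (-v u).
  move=> KNu; have [t Kt] := K_absorbing a0; apply: Ka0.
  case: (Rle_lt_dec 0 t) => t0.
    rewrite (_ : a0 = (a0 +v t *r u) +v t *r (-v u)); last by vlin.
    by apply: KD => //; apply: KZ.
  rewrite (_ : a0 = (a0 +v t *r u) +v (- t) *r u); last by vlin.
  by apply: KD => //; apply: KZ => //; lra.
move=> [k [s [Kk [[s0|<-] e]]]]; last first.
  by apply: KNu; rewrite e (_ : k +v _ = k) //; vlin.
apply: Ka0.
rewrite (_ : a0 = (/ s) *r (k +v u)).
  apply: KZ; last exact: KD.
  by apply: Rlt_le; apply: Rinv_0_lt_compat.
rewrite (_ : k = (k +v (- s) *r a0) +v s *r a0); last by vlin.
rewrite -e; vlin.
Qed.

Let maximal_cone : exists M : set E,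
  [/\ good M, (forall x, K0 x -> M x) & forall x, M x \/ M (-v x)].
Proof.
have [F FP totF|M [Mgood Mmax]] := @Zorn_bigcup E good.
  split.
  - move=> x y [X FX Xx] [Y FY Yy].
    have [XY|YX] := totF _ _ FX FY.
      by exists Y => //; have [+ _ _ _] := FP _ FY; apply=> //; apply: XY.
    by exists X => //; have [+ _ _ _] := FP _ FX; apply=> //; apply: YX.
  - move=> t x t0 [X FX Xx]; exists X => //.
    by have [_ + _ _] := FP _ FX; apply.
  - move=> x y Kx [X FX Xx]; exists X => //.
    by have [_ _ + _] := FP _ FX; apply.
  - by move=> [X FX Xx]; have [_ _ _] := FP _ FX; apply.
have maxM (B : set E) : (forall x, M x -> B x) -> good B -> forall x, B x -> M x.
  move=> MB gB x Bx; apply: contrapT => nMx; apply: (Mmax B) => //.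
  by split=> // /(_ _ Bx).
have [MD MZ MK Mu] := Mgood.
have K0M x : K0 x -> M x.
  move=> Kx; apply: (maxM (fun x => M x \/ K0 x)); [by left| |by right].
  split.
  - move=> y z [My|Ky] [Mz|Kz]; [left|left|left|right].
    + exact: MD.
    + by rewrite vaddC; apply: MK.
    + exact: MK.
    + exact: K0D.
  - by move=> t y t0 [My|Ky]; [left; apply: MZ|right; apply: K0Z => //; lra].
  - by move=> y z Ky [Mz|Kz]; [left; apply: MK|right; apply: K0D].
  - by move=> [/Mu|/K0u].
have K00 : K0 0v.
  rewrite (_ : 0v = 0 *r u); last by vlin.
  by apply: K0Z; [lra|apply: KK0].
(* By maximality the cone spanned by [M] and [b] contains [-v u]; the coefficient of [b] is positive
   because [M] itself does not contain [-v u]. *)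
have step b : ~ M b -> exists m t, M m /\ 0 < t /\ -v u = m +v t *r b.
  move=> nMb.
  pose B x := exists m t, M m /\ 0 <= t /\ x = m +v t *r b.
  have Bu : B (-v u).
    apply: contrapT => nBu; apply: nMb; apply: (maxM B).
    - by move=> x Mx; exists x, 0; split=> //; split; [lra | vlin].
    - split=> //.
      + move=> x y [m [t [Mm [t0 ->]]]] [m' [t' [Mm' [t0' ->]]]].
        exists (m +v m'), (t + t'); split; [exact: MD | split; [lra | vlin]].
      + move=> s x s0 [m [t [Mm [t0 ->]]]].
        exists (s *r m), (s * t); split; [exact: MZ | split; [nra | vlin]].
      + move=> x y Kx [m [t [Mm [t0 ->]]]].
        exists (x +v m), t; split; [exact: MK | split=> //; vlin].
    - exists 0v, 1; split; [exact: K0M | split; [lra | vlin]].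
  have [m [t [Mm [[t0|t0] e]]]] := Bu; first by exists m, t.
  case: Mu; rewrite e -t0 (_ : m +v _ = m) //; vlin.
exists M; split=> // x; apply: contrapT => /not_orP[/step[m [t [Mm [t0 e]]]]].
move=> /step[m' [t' [Mm' [t0' e']]]]; apply: Mu.
(* From -u = m + t x and -u = m' - t' x, the weights t' and t eliminate x. *)
rewrite (_ : -v u = (/ (t + t')) *r (t' *r m +v t *r m')).
  apply: (MZ (/ (t + t'))); first by apply: Rinv_0_lt_compat; lra.
  by apply: MD; apply: MZ.
rewrite (_ : m = -v u +v (- t) *r x); last by rewrite e; vlin.
rewrite (_ : m' = -v u +v t' *r x); last by rewrite e'; vlin.
by vlin.
Qed.

(* F a is the supremum of the t with a - t u in a maximal cone that contains K
   and - a0 but not - u; by maximality this cone and its opposite cover E. *)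
Lemma krein : exists F : E -> R,
  [/\ forall x y, F (x +v y) = F x + F y,
      forall t x, F (t *r x) = t * F x,
      forall x, K x -> 0 <= F x, F u = 1 & F a0 <= 0].
Proof.
have [M [[MD MZ MK Mu] K0M Mtot]] := maximal_cone.
have Mneg t : M (t *r u) -> 0 <= t.
  move=> Mt; case: (Rle_lt_dec 0 t) => // t0; case: Mu.
  rewrite (_ : -v u = (/ - t) *r (t *r u)); last by vlin.
  by apply: MZ => //; apply: Rinv_0_lt_compat; lra.
have Mpos t : 0 <= t -> M (t *r u) by move=> t0; apply: K0M; apply: K0Z => //; apply: KK0.
have exF a : exists r, (forall t, t < r -> M (a +v (- t) *r u)) /\
                       (forall t, r < t -> ~ M (a +v (- t) *r u)).
  have [r [rub rlub]] : {r | is_lub (fun t => M (a +v (- t) *r u)) r}.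
    apply: completeness.
      have [t0 Kt] := K_absorbing (-v a); exists t0 => t Mt.
      have := Mneg (t0 - t); rewrite (_ : _ *r u = (-v a +v t0 *r u) +v (a +v (- t) *r u)).
        by move=> h; have := h (MK _ _ (KK0 Kt) Mt); lra.
      by vlin.
    have [t0 Kt] := K_absorbing a; exists (- t0); rewrite Ropp_involutive.
    by apply: K0M; apply: KK0.
  exists r; split=> t tr; last by move=> /rub; lra.
  apply: contrapT => nM.
  have : r <= t; last lra.
  apply: rlub => s Ms; case: (Rle_lt_dec s t) => // ts; case: nM.
  rewrite (_ : _ +v _ = (a +v (- s) *r u) +v (s - t) *r u); last by vlin.
  by apply: MD => //; apply: Mpos; lra.
have [F FP] := boolp.choice exF.
have FD x y : F (x +v y) = F x + F y.
  have [xl xg] := FP x; have [yl yg] := FP y; have [l g] := FP (x +v y).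
  case: (Rtotal_order (F (x +v y)) (F x + F y)) => [lt|[//|gt]].
    pose d := (F x + F y - F (x +v y)) / 3.
    case: (g (F x - d + (F y - d))); first by rewrite /d; lra.
    rewrite (_ : _ +v _ = (x +v (- (F x - d)) *r u) +v (y +v (- (F y - d)) *r u)).
      by apply: MD; [apply: xl|apply: yl]; rewrite /d; lra.
    by vlin.
  (* Each of the three memberships below gives away [d]; out of a gap of 4 d this puts - d u into
     [M]. *)
  pose d := (F (x +v y) - (F x + F y)) / 4.
  have d0 : 0 < d by rewrite /d; lra.
  have Mx : M (-v (x +v (- (F x + d)) *r u)).
    by case: (Mtot (x +v (- (F x + d)) *r u)) => // /xg; lra.
  have My : M (-v (y +v (- (F y + d)) *r u)).
    by case: (Mtot (y +v (- (F y + d)) *r u)) => // /yg; lra.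
  have Mxy : M ((x +v y) +v (- (F (x +v y) - d)) *r u) by apply: l; lra.
  have := Mneg _ (_ : M ((- d) *r u)); rewrite (_ : (- d) *r u =
    -v (x +v (- (F x + d)) *r u) +v -v (y +v (- (F y + d)) *r u) +v
    ((x +v y) +v (- (F (x +v y) - d)) *r u)); last first.
    rewrite (_ : F (x +v y) = 4 * d + (F x + F y)); last by rewrite /d; lra.
    vlin.
  by move=> /(_ (MD _ _ (MD _ _ Mx My) Mxy)); lra.
have F0 : F 0v = 0 by have := FD 0v 0v; rewrite vadd0; lra.
have FN x : F (-v x) = - F x by have := FD x (-v x); rewrite vaddN F0; lra.
have FZpos t x : 0 < t -> F (t *r x) = t * F x.
  move=> t0; have [l g] := FP (t *r x); have [xl xg] := FP x.
  have ti : 0 < / t by apply: Rinv_0_lt_compat.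
  case: (Rtotal_order (F (t *r x)) (t * F x)) => [lt|[//|gt]].
    pose s := (F (t *r x) + t * F x) / 2.
    case: (g s); first by rewrite /s; lra.
    rewrite (_ : _ +v _ = t *r (x +v (- (/ t * s)) *r u)); last by vlin.
    apply: MZ => //; apply: xl; apply: (Rmult_lt_reg_l t) => //.
    by rewrite -Rmult_assoc Rinv_r /s; lra.
  pose s := (F (t *r x) + t * F x) / 2.
  case: (xg (/ t * s)).
    apply: (Rmult_lt_reg_l t) => //.
    by rewrite -Rmult_assoc Rinv_r /s; lra.
  rewrite (_ : _ +v _ = / t *r (t *r x +v (- s) *r u)); last by vlin.
  by apply: MZ => //; apply: l; rewrite /s; lra.
exists F; split=> //.
- move=> t x; case: (Rtotal_order t 0) => [lt|[->|gt]]; last exact: FZpos.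
    rewrite (_ : t *r x = -v ((- t) *r x)); last by vlin.
    by rewrite FN FZpos; lra.
  by rewrite (_ : 0 *r x = 0v) ?F0; [lra|vlin].
- move=> x Kx; have [_ g] := FP x.
  case: (Rle_lt_dec 0 (F x)) => // neg; case: (g (F x / 2)); first lra.
  apply: K0M; apply: K0D; first exact: KK0.
  by apply: K0Z; [lra|apply: KK0].
- have [l g] := FP u; case: (Rtotal_order (F u) 1) => [lt|[//|gt]].
    case: (g ((F u + 1) / 2)); first lra.
    rewrite (_ : _ +v _ = ((1 - F u) / 2) *r u); last by vlin.
    by apply: Mpos; lra.
  have := l ((F u + 1) / 2); rewrite (_ : _ +v _ = ((1 - F u) / 2) *r u); last by vlin.
  move=> /(_ _)/Mneg h; have : (F u + 1) / 2 < F u by lra.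
  by move=> /h; lra.
- have [l _] := FP a0; case: (Rle_lt_dec (F a0) 0) => // pos.
  have := Mneg (- (F a0 / 2)); rewrite (_ : _ *r u = (0v +v (- (1)) *r a0) +v
    (a0 +v (- (F a0 / 2)) *r u)); last by vlin.
  have K0a : K0 (0v +v (- (1)) *r a0).
    exists 0v, 1; split; last by split; [lra|].
    by rewrite (_ : 0v = 0 *r u); [apply: KZ => //; lra|vlin].
  have h : F a0 / 2 < F a0 by lra.
  by move=> /(_ (MK _ _ K0a (l _ h))); lra.
Qed.
End Krein.

(** * Finite sums and complex matrices *)

Definition funCV (T : Type) (V : CVSpace) : CVSpace.
refine {|
  cvs_car := T -> V;
  vzero := fun _ => 0v;
  vadd := fun x y t => x t +v y t;
  vopp := fun x t => -v x t;
  vscale := fun a x t => a *v x t |}; move=> *; apply: funext => t /=; vlin.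
Defined.

Definition prodCV (V W : CVSpace) : CVSpace.
refine {|
  cvs_car := (V * W)%type;
  vzero := (0v, 0v);
  vadd := fun x y => (x.1 +v y.1, x.2 +v y.2);
  vopp := fun x => (-v x.1, -v x.2);
  vscale := fun a x => (a *v x.1, a *v x.2) |};
  move=> *; (repeat match goal with x : (_ * _)%type |- _ => case: x => ? ? end);
  rewrite /=; congr pair; vlin.
Defined.

Definition CCV : CVSpace.
refine {| cvs_car := C; vzero := C0; vadd := Cadd; vopp := Copp;
          vscale := Cmul |}; move=> *; ring.
Defined.

Definition matCV (V : CVSpace) n m : CVSpace := funCV 'I_n (funCV 'I_m V).

Section Sums.
Variables (I : Type) (r : seq I) (P : pred I).

Lemma Cre_sum (F : I -> C) :
  Cre (\big[Cadd/C0]_(i <- r | P i) F i) = \big[Rplus/R0]_(i <- r | P i) Cre (F i).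
Proof. by apply: big_morph. Qed.

Lemma Cim_sum (F : I -> C) :
  Cim (\big[Cadd/C0]_(i <- r | P i) F i) = \big[Rplus/R0]_(i <- r | P i) Cim (F i).
Proof. by apply: big_morph. Qed.

Lemma Cconj_sum (F : I -> C) :
  Cconj (\big[Cadd/C0]_(i <- r | P i) F i)
  = \big[Cadd/C0]_(i <- r | P i) Cconj (F i).
Proof. by apply: big_morph; [exact: Cconj_add|ceq]. Qed.

Lemma Cmul_suml a (F : I -> C) :
  (a * \big[Cadd/C0]_(i <- r | P i) F i
   = \big[Cadd/C0]_(i <- r | P i) (a * F i))%C.
Proof. by apply: (big_morph (Cmul a)) => [x y|]; ring. Qed.

Lemma Cmul_sumr a (F : I -> C) :
  ((\big[Cadd/C0]_(i <- r | P i) F i) * a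
   = \big[Cadd/C0]_(i <- r | P i) (F i * a))%C.
Proof. by apply: (big_morph (fun x => x * a)%C) => [x y|]; ring. Qed.

Lemma Rmul_suml a (F : I -> R) :
  a * \big[Rplus/R0]_(i <- r | P i) F i
  = \big[Rplus/R0]_(i <- r | P i) (a * F i).
Proof. by apply: (big_morph (Rmult a)) => [x y|]; ring. Qed.

Lemma Rsum_ge0 (F : I -> R) :
  (forall i, P i -> 0 <= F i) -> 0 <= \big[Rplus/R0]_(i <- r | P i) F i.
Proof. by move=> h; apply: big_ind => //; [lra|move=> *; lra]. Qed.

Lemma Rsum_le (F G : I -> R) :
  (forall i, P i -> F i <= G i) ->
  \big[Rplus/R0]_(i <- r | P i) F i <= \big[Rplus/R0]_(i <- r | P i) G i.
Proof.
by move=> h; apply: (big_ind2 Rle) => //; [lra|move=> *; lra].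
Qed.
End Sums.

Lemma vsumE (T : Type) (V : CVSpace) I (r : seq I) (P : pred I)
    (F : I -> funCV T V) t :
  (\big[vadd/0v]_(i <- r | P i) F i) t = \big[vadd/0v]_(i <- r | P i) F i t.
Proof. by apply: (big_morph (fun x : funCV T V => x t)). Qed.

Definition clinear (E : CVSpace) (f : E -> C) :=
  (forall x y, f (x +v y) = (f x + f y)%C) /\
  (forall a x, f (a *v x) = (a * f x)%C).

Definition rlinear (E : CVSpace) (f : E -> R) :=
  (forall x y, f (x +v y) = f x + f y) /\ (forall t x, f (t *r x) = t * f x).

Lemma clinear0 (E : CVSpace) (f : E -> C) : clinear f -> f 0v = C0.
Proof.
by move=> [_ fZ]; rewrite -(vscale0 (0v : E)) fZ; ring.
Qed.

Lemma clinearN (E : CVSpace) (f : E -> C) x : clinear f -> f (-v x) = (- f x)%C.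
Proof. by move=> [_ fZ]; rewrite voppE fZ; ring. Qed.

Lemma clinear_sum (E : CVSpace) (f : E -> C) I (r : seq I) (P : pred I)
    (F : I -> E) : clinear f ->
  f (\big[vadd/0v]_(i <- r | P i) F i) = \big[Cadd/C0]_(i <- r | P i) f (F i).
Proof. by move=> fL; apply: big_morph; [case: fL|exact: clinear0]. Qed.

Definition complexify (E : CVSpace) (f : E -> R) (x : E) : C :=
  mkC (f x) (- f (Ci *v x)).

Lemma complexify_linear (E : CVSpace) (f : E -> R) :
  rlinear f -> clinear (complexify f).
Proof.
move=> [fD fZ]; split=> [x y|[a b] x]; rewrite /complexify.
  rewrite (_ : Ci *v (x +v y) = Ci *v x +v Ci *v y); last by vlin.
  by rewrite !fD; ceq.
rewrite (_ : mkC a b *v x = a *r x +v b *r (Ci *v x)); last by vlin.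
rewrite (_ : Ci *v (a *r x +v b *r (Ci *v x)) = a *r (Ci *v x) +v (- b) *r x); last by vlin.
by rewrite !fD !fZ; ceq.
Qed.

Definition sqnorm (T : finType) (v : T -> C) : R := \rsum_i Cabs2 (v i).
Definition dot (T : finType) (x y : T -> C) : C := \csum_i (x i * Cconj (y i)).

Lemma sqnorm_ge0 (T : finType) (v : T -> C) : 0 <= sqnorm v.
Proof. by apply: Rsum_ge0 => i _; exact: Cabs2_ge0. Qed.

Lemma dot_sqnorm (T : finType) (x : T -> C) : dot x x = RtoC (sqnorm x).
Proof.
apply: C_ext; rewrite ?Cre_sum ?Cim_sum /=.
  by apply: eq_bigr => i _; rewrite /Cabs2; ring.
by rewrite big1 // => i _; ring.
Qed.

Lemma sqnormZ (T : finType) a (x : T -> C) :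
  sqnorm (fun i => a * x i)%C = Cabs2 a * sqnorm x.
Proof. by rewrite /sqnorm Rmul_suml; apply: eq_bigr => i _; rewrite Cabs2_mul. Qed.

Lemma dot_conj (T : finType) (x y : T -> C) : dot y x = Cconj (dot x y).
Proof.
by rewrite /dot Cconj_sum; apply: eq_bigr => i _; rewrite Cconj_mul CconjK; ring.
Qed.

(** Expand |s x - y|^2 >= 0 and divide by [s]. Later estimates use this weighted form in place of
    the Cauchy-Schwarz inequality, with a weight chosen at each use. *)
Lemma dot_amgm (T : finType) (x y : T -> C) s : 0 < s ->
  2 * Cre (dot x y) <= s * sqnorm x + / s * sqnorm y.
Proof.
move=> s0; rewrite /dot Cre_sum !Rmul_suml -big_split /=; apply: Rsum_le => i _.
rewrite /Cabs2; case: (x i) (y i) => a b [c d] /=.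
have e : / s * s = 1 by rewrite Rinv_l //; lra.
have : 0 < / s by apply: Rinv_0_lt_compat.
move: (/ s) e => r e r0.
have h1 : 0 <= r * ((s * a - c) * (s * a - c) + (s * b - d) * (s * b - d)).
  apply: Rmult_le_pos; first lra.
  by apply: Rplus_le_le_0_compat; apply: Rle_0_sqr.
have -> : s * (a * a + b * b) = (r * s) * s * (a * a + b * b) by rewrite e; ring.
have -> : 2 * (a * c - b * - d) = 2 * (r * s) * (a * c + b * d) by rewrite e; ring.
by lra.
Qed.

Lemma cmatvec_adj k n (X : Mat C k n) w u :
  dot (cmatvec (cadj X) w) u = dot w (cmatvec X u).
Proof.
rewrite /dot /cmatvec /Csum.
under eq_bigr do rewrite Cmul_sumr.
rewrite exchange_big; apply: eq_bigr => i _ /=.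
rewrite Cconj_sum Cmul_suml; apply: eq_bigr => j _.
by rewrite /cadj Cconj_mul; ring.
Qed.

(** With u = X^*w one has |u|^2 = Re <X u, w>. The weight 1/c bounds 2 |u|^2 by |X u|^2 / c + c
    |w|^2, and the first term is at most |u|^2. *)
Lemma cadj_bound k n (X : Mat C k n) c : 0 < c ->
  (forall v, sqnorm (cmatvec X v) <= c * sqnorm v) ->
  forall w, sqnorm (cmatvec (cadj X) w) <= c * sqnorm w.
Proof.
move=> c0 h w; set u := cmatvec _ w.
have e : sqnorm u = Cre (dot (cmatvec X u) w).
  by rewrite dot_conj -cmatvec_adj dot_sqnorm.
have ci : 0 < / c by apply: Rinv_0_lt_compat.
have := dot_amgm (cmatvec X u) w ci; rewrite -e Rinv_inv.
have := Rmult_le_compat_l _ _ _ (Rlt_le _ _ ci) (h u).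
rewrite -Rmult_assoc Rinv_l; lra.
Qed.

Definition stack T k1 k2 m (X : Mat T k1 m) (Y : Mat T k2 m) : Mat T (k1 + k2) m :=
  fun i => match split i with inl a => X a | inr b => Y b end.

Lemma split_lshiftE m n (i : 'I_m) : split (lshift n i) = inl i.
Proof. exact: (unsplitK (inl i)). Qed.
Lemma split_rshiftE m n (i : 'I_n) : split (rshift m i) = inr i.
Proof. exact: (unsplitK (inr i)). Qed.

Definition cid_mx n : Mat C n n := fun i j => if i == j then C1 else C0.
Arguments cid_mx : clear implicits.
Definition cscale n m a (X : Mat C n m) : Mat C n m := fun i j => (a * X i j)%C.

Lemma cadjK n m (X : Mat C n m) : cadj (cadj X) = X.
Proof. by apply: funext => i; apply: funext => j; rewrite /cadj CconjK. Qed.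

Lemma cadj_cid_mx n : cadj (cid_mx n) = cid_mx n.
Proof.
apply: funext => i; apply: funext => j; rewrite /cadj /cid_mx eq_sym.
by case: eqP => _; ceq.
Qed.

Lemma cadj_cscale n m a (X : Mat C n m) :
  cadj (cscale a X) = cscale (Cconj a) (cadj X).
Proof. by apply: funext => i; apply: funext => j; rewrite /cadj Cconj_mul. Qed.

Lemma csum_delta n (i : 'I_n) (F : 'I_n -> C) :
  \csum_(j < n) (cid_mx n i j * F j) = F i.
Proof.
rewrite (bigD1 i) //= /cid_mx eqxx big1 => [|j]; first by ring.
by rewrite eq_sym => /negbTE ->; ring.
Qed.

Lemma cmatvec_cid_mx n (v : 'I_n -> C) : cmatvec (cid_mx n) v = v.
Proof. by apply: funext => i; rewrite /cmatvec /Csum csum_delta. Qed.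

Lemma cmatvec_cscale n m a (X : Mat C n m) v :
  cmatvec (cscale a X) v = (fun i => a * cmatvec X v i)%C.
Proof.
apply: funext => i; rewrite /cmatvec /Csum Cmul_suml; apply: eq_bigr => j _.
rewrite /cscale; ring.
Qed.

Lemma sqnorm_stack k1 k2 m (X : Mat C k1 m) (Y : Mat C k2 m) v :
  sqnorm (cmatvec (stack X Y) v) = sqnorm (cmatvec X v) + sqnorm (cmatvec Y v).
Proof.
rewrite /sqnorm big_split_ord; congr Rplus; apply: eq_bigr => i _;
  by rewrite /cmatvec /stack ?split_lshiftE ?split_rshiftE.
Qed.

(** * Matrices over a vector space as a bimodule over scalar matrices *)

Section MatrixModule.
Variable V : CVSpace.

Lemma mat_ext n m (A B : Mat V n m) : (forall i j, A i j = B i j) -> A = B.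
Proof. by move=> h; apply: funext => i; apply: funext => j. Qed.

(** The off-diagonal corners of a direct sum vanish. A sum of two products thus becomes one product,
    the shape to which Ruan's axioms apply. *)
Lemma smul_stack k1 k2 l1 l2 n m (X1 : Mat C k1 n) (X2 : Mat C k2 n)
    (A : Mat V k1 l1) (B : Mat V k2 l2) (Y1 : Mat C l1 m) (Y2 : Mat C l2 m) :
  smul (cadj (stack X1 X2)) (dsum A B) (stack Y1 Y2)
  = madd (smul (cadj X1) A Y1) (smul (cadj X2) B Y2).
Proof.
apply: mat_ext => i j; rewrite /smul /vsum /madd big_split_ord /=.
congr vadd; apply: eq_bigr => a _; rewrite big_split_ord /=.
  rewrite [X in _ +v X]big1 ?vadd0 => [|b _].
    apply: eq_bigr => b _.
    by rewrite /cadj /stack /dsum !split_lshiftE.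
  by rewrite /dsum split_lshiftE split_rshiftE vscaler0.
rewrite [X in X +v _]big1 ?vadd0l => [|b _].
  apply: eq_bigr => b _.
  by rewrite /cadj /stack /dsum !split_rshiftE.
by rewrite /dsum split_lshiftE split_rshiftE vscaler0.
Qed.

Lemma smul_cid_mx n m (A : Mat V n m) : smul (cid_mx n) A (cid_mx m) = A.
Proof.
apply: mat_ext => i j; rewrite /smul /vsum (bigD1 i) //= (bigD1 j) //=.
rewrite /cid_mx !eqxx big1 => [|b /negbTE ->].
  rewrite big1 => [|a]; first by vlin.
  by rewrite eq_sym => /negbTE -> ; rewrite big1 // => b _; vlin.
by vlin.
Qed.

Lemma smul_cscale k n m l a b (X : Mat C k n) (A : Mat V n m) (Y : Mat C m l) :
  smul (cscale a X) A (cscale b Y) = mscale (a * b)%C (smul X A Y).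
Proof.
apply: mat_ext => i j; rewrite /smul /vsum /mscale vscaleDr_sum.
apply: eq_bigr => p _; rewrite vscaleDr_sum; apply: eq_bigr => q _.
by rewrite /cscale; vlin.
Qed.

Lemma smul_mscale k n m l a (X : Mat C k n) (A : Mat V n m) (Y : Mat C m l) :
  smul X (mscale a A) Y = mscale a (smul X A Y).
Proof.
apply: mat_ext => i j; rewrite /smul /vsum /mscale vscaleDr_sum.
apply: eq_bigr => p _; rewrite vscaleDr_sum; apply: eq_bigr => q _.
by vlin.
Qed.

Lemma smul0 k l (X : Mat C k 0) (A : Mat V 0 0) (Y : Mat C 0 l) :
  smul X A Y = @mzero V k l.
Proof. by apply: mat_ext => i j; rewrite /smul /vsum big_ord0. Qed.

Variable star : V -> V.
Hypothesis starP : star_vector_space star.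

Lemma starD x y : star (x +v y) = star x +v star y.
Proof. by case: starP => _ []. Qed.
Lemma starZ a x : star (a *v x) = Cconj a *v star x.
Proof. by case: starP => _ []. Qed.
Lemma starK x : star (star x) = x.
Proof. by case: starP. Qed.
Lemma star0 : star 0v = 0v.
Proof. by rewrite -(vscale0 0v) starZ (_ : Cconj C0 = C0) ?vscale0 //; ceq. Qed.
Lemma starN x : star (-v x) = -v star x.
Proof. by rewrite !voppE starZ; congr vscale; ceq. Qed.

Lemma star_sum I (r : seq I) (P : pred I) (F : I -> V) :
  star (\big[vadd/0v]_(i <- r | P i) F i)
  = \big[vadd/0v]_(i <- r | P i) star (F i).
Proof. by apply: big_morph; [exact: starD|exact: star0]. Qed.

Lemma mstarK n m (A : Mat V n m) : mstar star (mstar star A) = A.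
Proof. by apply: mat_ext => i j; rewrite /mstar starK. Qed.

Lemma mstar_smul k n m l (X : Mat C k n) (A : Mat V n m) (Y : Mat C m l) :
  mstar star (smul X A Y) = smul (cadj Y) (mstar star A) (cadj X).
Proof.
apply: mat_ext => i j; rewrite /mstar /smul /vsum star_sum.
under eq_bigr do rewrite star_sum.
rewrite exchange_big; apply: eq_bigr => p _; apply: eq_bigr => q _.
by rewrite starZ Cconj_mul /cadj; vlin.
Qed.
End MatrixModule.

(** The axiom is stated for the exact operator norms of X and Y; this version accepts any upper
    bounds. The exact norms exist as suprema: the given bound makes the set bounded, and the zero
    vector makes it nonempty with a nonnegative supremum. *)
Lemma ruan_bound (V : NormalMOStarOpSpace) k n m l (X : Mat C k n)
    (A : Mat V n m) (Y : Mat C m l) c d : 0 <= c -> 0 <= d ->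
  (forall v, sqnorm (cmatvec X v) <= c * c * sqnorm v) ->
  (forall v, sqnorm (cmatvec Y v) <= d * d * sqnorm v) ->
  mnorm (smul X A Y) <= c * mnorm A * d.
Proof.
move=> c0 d0 hX hY.
have lub k' n' (Z : Mat C k' n') e : 0 <= e ->
    (forall v, sqnorm (cmatvec Z v) <= e * e * sqnorm v) ->
    exists z, [/\ is_cmat_opnorm Z z, 0 <= z & z <= e].
  move=> e0 hZ.
  have ub : is_upper_bound
      (fun r => exists v, cvnorm v <= 1 /\ r = cvnorm (cmatvec Z v)) e.
    move=> _ [v [v1 ->]]; rewrite -(sqrt_square e) //; apply: sqrt_le_1_alt.
    apply: Rle_trans (hZ v) _; rewrite -[X in _ <= X]Rmult_1_r.
    apply: Rmult_le_compat_l; first by nra.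
    rewrite -[sqnorm v]sqrt_sqrt; last exact: sqnorm_ge0.
    by have := sqrt_pos (sqnorm v); rewrite /cvnorm /Rsum -/(sqnorm v) in v1 *; nra.
  have z0 : exists v, cvnorm v <= 1 /\ 0 = cvnorm (cmatvec Z v).
    have Z0 : cmatvec Z (fun _ => C0) = (fun _ => C0).
      apply: funext => i; rewrite /cmatvec /Csum big1 // => j _; ring.
    have nz p : cvnorm (fun _ : 'I_p => C0) = 0.
      by rewrite /cvnorm /Rsum big1 ?sqrt_0 // => i _; rewrite /Cabs2 /=; ring.
    by exists (fun _ => C0); rewrite Z0 !nz; split=> //; lra.
  have [z zl] := completeness _ (ex_intro _ e ub) (ex_intro _ _ z0).
  exists z; split=> //; first by case: zl => h _; apply: h.
  by case: zl => _; apply.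
have [x [Xx x0 xc]] := lub _ _ X c c0 hX.
have [y [Yy y0 yd]] := lub _ _ Y d d0 hY.
have [/(_ _ _ _ _ X A Y x y Xx Yy) h _] := nv_ruan V.
have [A0 _] := nv_norms V n m; have {}A0 := A0 A.
apply: Rle_trans h _; apply: Rmult_le_compat => //; first by nra.
by apply: Rmult_le_compat_r.
Qed.

(** * The cone of pairs *)

Section PairCone.
Variables (V : NormalMOStarOpSpace) (N : nat).
Local Notation star := (@vstar V).
Local Notation mst := (mstar (@vstar V)).
Local Notation MV := (matCV V N N).
Local Notation MC := (matCV CCV N N).
Local Notation E := (prodCV MV MC).

Definition qf (q : Mat C N N) (v : 'I_N -> C) : C := dot (cmatvec q v) v.

Definition symm_part k l (X : Mat C k N) (B : Mat V k l) (Y : Mat C l N) : Mat V N N :=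
  madd (smul (cadj X) B Y) (mst (smul (cadj X) B Y)).

(* Stacking (X, Y) and taking direct sums of B makes this closed under sums. *)
Definition pair_cone (a : E) : Prop :=
  exists k l (X : Mat C k N) (Y : Mat C l N) (B : Mat V k l) (P : Mat V N N),
    [/\ mnorm B <= 1, mcone P, madd a.1 (mst a.1) = madd (symm_part X B Y) P &
        forall v, sqnorm (cmatvec X v) + sqnorm (cmatvec Y v) <= 2 * Cre (qf a.2 v)].

Lemma qfE q v : qf q v = \csum_i \csum_j (q i j * v j * Cconj (v i)).
Proof. by apply: eq_bigr => i _; rewrite Cmul_sumr. Qed.

Lemma qfD (q q' : MC) v : qf (q +v q') v = (qf q v + qf q' v)%C.
Proof.
rewrite !qfE -big_split; apply: eq_bigr => i _; rewrite -big_split.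
by apply: eq_bigr => j _ /=; ring.
Qed.

Lemma qfZ a (q : MC) v : qf (a *v q) v = (a * qf q v)%C.
Proof.
rewrite !qfE Cmul_suml; apply: eq_bigr => i _; rewrite Cmul_suml.
by apply: eq_bigr => j _ /=; ring.
Qed.

Lemma qf0 v : qf (0v : MC) v = C0.
Proof. by rewrite -(vscale0 (0v : MC)) qfZ; ring. Qed.

Lemma qf_id v : qf (cid_mx N) v = RtoC (sqnorm v).
Proof. by rewrite /qf cmatvec_cid_mx dot_sqnorm. Qed.

Lemma qf_adj q v : qf (cadj q) v = Cconj (qf q v).
Proof. by rewrite /qf cmatvec_adj dot_conj. Qed.

Lemma qf_bound q : exists M, forall v, - (M * sqnorm v) <= Cre (qf q v).
Proof.
(* Completing the square gives - 2 Re (q_ij v_j conj(v_i)) <= |q_ij v_j|^2 + |v_i|^2 for each entry,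
   and this is at most (|q_ij|^2 + 1) |v|^2. *)
exists (\rsum_i \rsum_j (Cabs2 (q i j) + 1)) => v.
have -> : - ((\rsum_i \rsum_j (Cabs2 (q i j) + 1)) * sqnorm v)
    = \rsum_i \rsum_j (- sqnorm v * (Cabs2 (q i j) + 1)).
  transitivity (- sqnorm v * \rsum_i \rsum_j (Cabs2 (q i j) + 1)); first by ring.
  by rewrite Rmul_suml; apply: eq_bigr => i _; rewrite Rmul_suml.
rewrite qfE Cre_sum; apply: Rsum_le => i _; rewrite Cre_sum.
apply: Rsum_le => j _.
have le k : Cabs2 (v k) <= sqnorm v.
  rewrite /sqnorm (bigD1 k) //= -[X in X <= _]Rplus_0_r; apply: Rplus_le_compat_l.
  by apply: Rsum_ge0 => m _; exact: Cabs2_ge0.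
have h1 := le i; have h2 := le j.
have h3 := Cabs2_ge0 (q i j).
have h4 : Cabs2 (q i j * v j) <= Cabs2 (q i j) * sqnorm v.
  by rewrite Cabs2_mul; apply: Rmult_le_compat_l.
have h5 : 0 <= sqnorm v := sqnorm_ge0 v.
have h6 : 0 <= Cabs2 (q i j * v j + v i) := Cabs2_ge0 _.
have h7 : Cabs2 (q i j * v j + v i) = Cabs2 (q i j * v j) + Cabs2 (v i)
   + 2 * Cre (q i j * v j * Cconj (v i)).
  by rewrite /Cabs2 /=; ring.
by nra.
Qed.

Lemma mnorm0 n m : mnorm (@mzero V n m) = 0.
Proof.
have [_ [_ [h _]]] := nv_norms V n m.
rewrite -[RHS](Rmult_0_l (mnorm (@mzero V n m))) -[X in X * _](Cabs_RtoC (Rle_refl 0)).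
by rewrite -h; congr mnorm; apply: mat_ext => i j; rewrite /mscale vscaler0.
Qed.

Lemma mnorm_ge0 n m (A : Mat V n m) : 0 <= mnorm A.
Proof. by have [h _] := nv_norms V n m. Qed.

Lemma mnormZ n m t (A : Mat V n m) : 0 <= t ->
  mnorm (mscale (RtoC t) A) = t * mnorm A.
Proof. by move=> t0; have [_ [_ [-> _]]] := nv_norms V n m; rewrite Cabs_RtoC. Qed.

Lemma mnorm_eq0 n m (A : Mat V n m) : mnorm A = 0 -> A = @mzero V n m.
Proof. by have [_ [h _]] := nv_norms V n m; exact: h. Qed.

Lemma mcone0 n : mcone (@mzero V n n).
Proof. by have [/(_ n)[_ []]] := nv_ordered V. Qed.

Lemma mconeD n (A B : Mat V n n) : mcone A -> mcone B -> mcone (madd A B).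
Proof. by have [/(_ n)[_ [_ [h _]]] _] := nv_ordered V; exact: h. Qed.

Lemma mconeZ n t (A : Mat V n n) : 0 <= t -> mcone A -> mcone (mscale (RtoC t) A).
Proof. by have [/(_ n)[_ [_ [_ [h _]]]] _] := nv_ordered V; exact: h. Qed.

Lemma mcone_sa n (A : Mat V n n) : mcone A -> mst A = A.
Proof. by have [/(_ n)[h _] _] := nv_ordered V; exact: h. Qed.

Lemma nv_starP : star_vector_space star. Proof. exact: nv_star. Qed.

Lemma pair_coneD a b : pair_cone a -> pair_cone b -> pair_cone (a +v b).
Proof.
case: a b => [A1 q1] [A2 q2].
move=> [k [l [X [Y [B [P [B1 PP /= e h]]]]]]].
move=> [k' [l' [X' [Y' [B' [P' [B1' PP' /= e' h']]]]]]].
exists (k + k')%N, (l + l')%N, (stack X X'), (stack Y Y'), (dsum B B'), (madd P P').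
split; last 1 first.
- move=> v; rewrite !sqnorm_stack qfD /=.
  by have := h v; have := h' v; lra.
- by have [_ ->] := nv_ruan V; apply: Rmax_lub.
- exact: mconeD.
apply: mat_ext => i j; rewrite /symm_part smul_stack.
move/(congr1 (fun M : Mat V N N => M i j)): e.
move/(congr1 (fun M : Mat V N N => M i j)): e'.
rewrite /symm_part /madd /mstar /= !(starD nv_starP) => e' e.
transitivity ((A1 i j +v star (A1 j i)) +v (A2 i j +v star (A2 j i))).
  by vlin.
by rewrite e e'; vlin.
Qed.

Lemma pair_coneZ t a : 0 <= t -> pair_cone a -> pair_cone (t *r a).
Proof.
case: a => [A q] t0 [k [l [X [Y [B [P [B1 PP /= e h]]]]]]].
have tt : (RtoC (sqrt t) * RtoC (sqrt t))%C = RtoC t.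
  by apply: C_ext => /=; rewrite ?sqrt_sqrt //; ring.
(* The factor t is split evenly over X and Y, which keeps the bound on [B] and multiplies the cost
   by t. *)
exists k, l, (cscale (RtoC (sqrt t)) X), (cscale (RtoC (sqrt t)) Y), B, (mscale (RtoC t) P).
split=> //; first exact: mconeZ.
  apply: mat_ext => i j.
  rewrite /symm_part cadj_cscale smul_cscale Cconj_RtoC tt.
  move/(congr1 (fun M : Mat V N N => M i j)): e.
  rewrite /symm_part /madd /mstar /mscale /= !(starZ nv_starP) Cconj_RtoC => e.
  transitivity (t *r (A i j +v star (A j i))); first by vlin.
  by rewrite e; vlin.
move=> v; rewrite !cmatvec_cscale !sqnormZ qfZ (_ : Cabs2 (RtoC (sqrt t)) = t).
  rewrite [Cre _](_ : _ = t * Cre (qf q v)); last by rewrite /=; ring.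
  by have := Rmult_le_compat_l _ _ _ t0 (h v); lra.
by rewrite /Cabs2 /= sqrt_sqrt //; ring.
Qed.

Definition pair_unit : E := (0v, cid_mx N : MC).

(** A matrix [B] of size 0 by 0 makes the norm part disappear. Symmetry and positivity of a
    separating functional are read off from such pairs. *)
Lemma pair_cone_no_norm (A : MV) (q : MC) P : mcone P -> madd A (mst A) = P ->
  (forall v, 0 <= Cre (qf q v)) -> pair_cone (A, q).
Proof.
move=> PP e h.
exists 0%N, 0%N, (fun i : 'I_0 => fun=> C0), (fun i : 'I_0 => fun=> C0), (@mzero V 0 0), P.
split=> //; first by rewrite mnorm0; lra.
  rewrite e /symm_part smul0; apply: mat_ext => i j.
  by rewrite /madd /mstar /mzero star0 ?vadd0 ?vadd0l //; exact: nv_starP.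
by move=> v; rewrite /sqnorm !big_ord0 /=; have := h v; lra.
Qed.

Lemma pair_cone_unit : pair_cone pair_unit.
Proof.
apply: (pair_cone_no_norm (mcone0 N)).
  by apply: mat_ext => i j; rewrite /madd /mstar /= (star0 nv_starP) vadd0.
by move=> v; rewrite qf_id; exact: sqnorm_ge0.
Qed.

Lemma pair_cone_absorbing a : exists t, pair_cone (a +v t *r pair_unit).
Proof.
case: a => A q; have [M hM] := qf_bound q.
(* Here A = X^*(A/s)X with X = sqrt(s) 1, at cost 2 s, and [M] compensates for the negative part of
   [q]. The summand 1 keeps [s] invertible when A = 0. *)
pose s := mnorm A + 1; have s0 : 0 < s by have := mnorm_ge0 A; rewrite /s; lra.
pose X := cscale (RtoC (sqrt s)) (cid_mx N).
have ss : (RtoC (sqrt s) * RtoC (sqrt s))%C = RtoC s.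
  by apply: C_ext => /=; rewrite ?sqrt_sqrt ?Rmult_0_r; lra.
have si : 0 < / s by apply: Rinv_0_lt_compat.
exists (s + M), N, N, X, X, (mscale (RtoC (/ s)) A), (@mzero V N N).
split; last 1 first.
- move=> v; rewrite cmatvec_cscale sqnormZ cmatvec_cid_mx qfD qfZ qf_id.
  rewrite (_ : Cabs2 (RtoC (sqrt s)) = s); last first.
    by rewrite /Cabs2 /= sqrt_sqrt; lra.
  by have := hM v; rewrite /=; lra.
- rewrite mnormZ; last lra.
  apply: (Rmult_le_reg_l s) => //; rewrite -Rmult_assoc Rinv_r; last lra.
  by rewrite /s; lra.
- exact: mcone0.
rewrite /symm_part /X cadj_cscale smul_cscale Cconj_RtoC ss cadj_cid_mx smul_cid_mx.
apply: mat_ext => i j; rewrite /madd /mstar /mscale /mzero /=.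
rewrite !(starD nv_starP) !(starZ nv_starP) (star0 nv_starP) !Cconj_RtoC; vlin.
Qed.

Definition pair_at (A : Mat V N N) (c : R) : E := (A : MV, RtoC c *v (cid_mx N : MC)).

(* The symmetric part of X^*BY is [X;Y]^* D [Y;X] with D the direct sum of B
   and B^*, so Ruan's axioms bound its norm by that of X^*X + Y^*Y. *)
Lemma pair_cone_decomp A c : mst A = A -> 0 < c -> pair_cone (pair_at A c) ->
  exists Q P, [/\ mst Q = Q, mcone P, mnorm Q <= c & A = madd Q P].
Proof.
move=> sA c0 [k [l [X [Y [B [P [B1 PP /= e h]]]]]]].
pose Q := symm_part X B Y.
(* The cone speaks of A + A^* = 2 A, so both parts are halved. *)
exists (mscale (RtoC (/ 2)) Q), (mscale (RtoC (/ 2)) P).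
have sQ : mst Q = Q.
  apply: mat_ext => i j.
  by rewrite /Q /symm_part /madd /mstar (starD nv_starP) (starK nv_starP) vaddC.
split.
- apply: mat_ext => i j; rewrite /mscale /mstar (starZ nv_starP) Cconj_RtoC.
  by congr vscale; rewrite -{2}sQ.
- by apply: mconeZ => //; lra.
- rewrite mnormZ; last lra.
  suff : mnorm Q <= 2 * c by lra.
  have -> : Q = smul (cadj (stack X Y)) (dsum B (mst B)) (stack Y X).
    by rewrite smul_stack /Q /symm_part (mstar_smul nv_starP) cadjK.
  have bnd v : sqnorm (cmatvec X v) + sqnorm (cmatvec Y v) <= 2 * c * sqnorm v.
    by have := h v; rewrite qfZ qf_id /=; lra.
  have r0 := sqrt_pos (2 * c).
  have rr : sqrt (2 * c) * sqrt (2 * c) = 2 * c by rewrite sqrt_sqrt; lra.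
  apply: Rle_trans (ruan_bound (c := sqrt (2 * c)) (d := sqrt (2 * c)) _ r0 r0 _ _) _.
  + rewrite rr; apply: cadj_bound; first lra.
    by move=> v; rewrite sqnorm_stack.
  + by move=> v; rewrite sqnorm_stack rr; have := bnd v; lra.
  + have [_ ->] := nv_ruan V; rewrite (@nv_star_isom V) Rmax_left; last lra.
    by have := mnorm_ge0 B; nra.
apply: mat_ext => i j; move/(congr1 (fun M : Mat V N N => M i j)): e.
rewrite -/Q {1}sA /madd /mscale => e.
rewrite -vscaleDr -e; vlin.
Qed.
End PairCone.

(** * Separating functionals as sesquilinear forms *)

(** Stands for <psi(B) y, x> before a block psi exists. *)
Definition form_sum (V W : CVSpace) (g : V -> W -> W -> C) k l
    (B : Mat V k l) (y : 'I_l -> W) (x : 'I_k -> W) : C :=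
  \csum_a \csum_b g (B a b) (y b) (x a).

(** What a block looks like before a basis is chosen, with [p], possibly degenerate, as inner
    product. [form_gbound] is complete contractivity in arithmetic-geometric form. *)
Record ccp_form (V : NormalMOStarOpSpace) (W : CVSpace)
    (p : W -> W -> C) (g : V -> W -> W -> C) : Prop := {
  form_pl : forall x, clinear (fun y => p y x);
  form_pconj : forall x y, p x y = Cconj (p y x);
  form_ppos : forall x, 0 <= Cre (p x x);
  form_gv : forall y x, clinear (fun v => g v y x);
  form_gl : forall v x, clinear (fun y => g v y x);
  form_gstar : forall v y x, g (vstar v) y x = Cconj (g v x y);
  form_gbound : forall k l (B : Mat V k l) y x,
    2 * Cre (form_sum g B y x)
    <= mnorm B * (\rsum_a Cre (p (x a) (x a)) + \rsum_b Cre (p (y b) (y b)));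
  form_gpos : forall k (P : Mat V k k) x,
    mcone P -> 0 <= Cre (form_sum g P x x)
}.

Section Separation.
Variables (V : NormalMOStarOpSpace) (N : nat).
Local Notation star := (@vstar V).
Local Notation mst := (mstar (@vstar V)).
Local Notation MV := (matCV V N N).
Local Notation MC := (matCV CCV N N).
Local Notation E := (prodCV MV MC).
Local Notation W := (funCV 'I_N CCV).

Variable F : E -> R.
Hypothesis FL : rlinear F.
Hypothesis Fpos : forall a, pair_cone a -> 0 <= F a.

Let fV (A : MV) : R := F (A, 0v).
Let fC (q : MC) : R := F (0v, q).

Let F_split A q : F (A, q) = fV A + fC q.
Proof.
rewrite /fV /fC; have [<- _] := FL; congr F; congr pair.
  by apply: mat_ext => i j /=; vlin.
by apply: mat_ext => i j /=; ceq.
Qed.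

Let fV_lin : rlinear fV.
Proof.
have [FD FZ] := FL; split=> [x y|t x]; rewrite /fV.
  by rewrite -FD; congr F; congr pair; apply: mat_ext => i j /=; ceq || vlin.
by rewrite -FZ; congr F; congr pair; apply: mat_ext => i j /=; ceq || vlin.
Qed.

Let fC_lin : rlinear fC.
Proof.
have [FD FZ] := FL; split=> [x y|t x]; rewrite /fC.
  by rewrite -FD; congr F; congr pair; apply: mat_ext => i j /=; ceq || vlin.
by rewrite -FZ; congr F; congr pair; apply: mat_ext => i j /=; ceq || vlin.
Qed.

Let rlinear_sub0 (U : CVSpace) (f : U -> R) x y :
  rlinear f -> 0 <= f (x +v (- (1)) *r y) -> 0 <= f (y +v (- (1)) *r x) -> f x = f y.
Proof. by move=> [fD fZ]; rewrite !fD !fZ; lra. Qed.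

(** The imaginary part of [complexify f] is - f (i x), and a conjugate-linear [s] turns i x into - i
    (s x), which flips its sign. *)
Let complexify_conj (U : CVSpace) (f : U -> R) (s : U -> U) :
  rlinear f -> (forall x, f (s x) = f x) ->
  (forall x, s (Ci *v x) = (- Ci)%C *v s x) ->
  forall x, complexify f (s x) = Cconj (complexify f x).
Proof.
move=> [_ fZ] fs sI x; apply: C_ext => /=; first exact: fs.
rewrite -[X in - - X]fs sI.
rewrite (_ : (- Ci)%C *v s x = (- (1)) *r (Ci *v s x)); last by vlin.
by rewrite fZ; ring.
Qed.

Let gV := complexify fV.
Let gC := complexify fC.
Let gVL : clinear gV := complexify_linear fV_lin.
Let gCL : clinear gC := complexify_linear fC_lin.

Let gV_star A : gV (mst A : MV) = Cconj (gV A).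
Proof.
apply: (complexify_conj (s := fun A : MV => mst A : MV)) => [||B].
- exact: fV_lin.
(* With D = B^* the matrix B - D is skew-adjoint, so it and its opposite both enter the cone with
   second component 0; hence [fV] agrees on B and D. *)
- have key (B D : MV) : mst B = D -> 0 <= fV (B +v (- (1)) *r D).
    move=> <-; apply: Fpos; apply: (pair_cone_no_norm (mcone0 V N)).
      apply: mat_ext => i j; rewrite /madd /mstar /= /mzero.
      rewrite (starD (nv_starP V)) (starZ (nv_starP V)) !(starK (nv_starP V)) Cconj_RtoC; vlin.
    by move=> v; rewrite qf0 /=; lra.
  move=> B; apply: rlinear_sub0; first exact: fV_lin.
    by apply: key; rewrite (mstarK (nv_starP V)).
  exact: key.
apply: mat_ext => i j; rewrite /mstar /= (starZ (nv_starP V)).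
by congr vscale; ceq.
Qed.

Let gC_adj q : gC (cadj q : MC) = Cconj (gC q).
Proof.
apply: (complexify_conj (s := fun q : MC => cadj q : MC)) => [||B].
- exact: fC_lin.
(* Here Re <(B - D) v, v> = 0 for all v, so the same argument works in the second component. *)
- have key (B D : MC) : cadj B = D -> 0 <= fC (B +v (- (1)) *r D).
    move=> e; apply: Fpos; apply: (pair_cone_no_norm (mcone0 V N)).
      by apply: mat_ext => i j; rewrite /madd /mstar /= (star0 (nv_starP V)) vadd0.
    by move=> v; rewrite qfD qfZ -e qf_adj /=; lra.
  move=> B; apply: rlinear_sub0; first exact: fC_lin.
    by apply: key; rewrite cadjK.
  exact: key.
by apply: mat_ext => i j; rewrite /cadj /=; ceq.
Qed.

(** Values on rank-one matrices: with x and y read as rows these are x^*y and x^*vy. Rows stack to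
    matrices X and Y, so sums of such values are values at X^*X and X^*BY. *)
Definition sep_p (y x : W) : C := gC (fun i j => (Cconj (x i) * y j)%C).
Definition sep_g (v : V) (y x : W) : C :=
  gV (fun i j => (Cconj (x i) * y j)%C *v v).

Lemma form_sum_sep k l (B : Mat V k l) (y : 'I_l -> W) (x : 'I_k -> W) :
  form_sum sep_g B y x = gV (smul (cadj (x : Mat C k N)) B (y : Mat C l N)).
Proof.
rewrite /form_sum /sep_g.
have -> : smul (cadj (x : Mat C k N)) B (y : Mat C l N) =
    \vsum_a \vsum_b ((fun i j => (Cconj (x a i) * y b j)%C *v B a b) : MV).
  apply: mat_ext => i j; rewrite /smul /vsum !vsumE; apply: eq_bigr => a _.
  by rewrite !vsumE.
rewrite clinear_sum //; apply: eq_bigr => a _.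
by rewrite clinear_sum.
Qed.

Lemma sep_pE k (x : 'I_k -> W) :
  \rsum_a Cre (sep_p (x a) (x a))
  = fC (\vsum_a ((fun i j => (Cconj (x a i) * x a j)%C) : MC)).
Proof.
rewrite -[fC _]/(Cre (gC _)) clinear_sum // Cre_sum; exact: eq_bigr.
Qed.

Lemma qf_outer (x : W) v :
  qf (fun i j => (Cconj (x i) * x j)%C) v = RtoC (Cabs2 (\csum_j (x j * v j))).
Proof.
have e z : RtoC (Cabs2 z) = (z * Cconj z)%C by rewrite /Cabs2; ceq.
rewrite e Cconj_sum Cmul_suml; apply: eq_bigr => i _.
rewrite /cmatvec /Csum !Cmul_sumr; apply: eq_bigr => j _.
by rewrite Cconj_mul; ring.
Qed.

Lemma qf_outer_sum k (x : 'I_k -> W) v :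
  Cre (qf (\vsum_a ((fun i j => (Cconj (x a i) * x a j)%C) : MC)) v)
  = sqnorm (cmatvec (x : Mat C k N) v).
Proof.
have qL : clinear (fun q : MC => qf q v) by split=> *; rewrite ?qfD ?qfZ.
rewrite (clinear_sum _ _ _ qL) Cre_sum; apply: eq_bigr => a _.
by rewrite qf_outer.
Qed.

(** The pair of X^*BY and (X^*X + Y^*Y)/2 lies in the cone, with equality in the scalar condition.
    The upper bound follows later by inserting - B. *)
Let sep_bound1 k l (B : Mat V k l) (y : 'I_l -> W) (x : 'I_k -> W) :
  mnorm B <= 1 ->
  - (2 * Cre (form_sum sep_g B y x)) <=
  \rsum_a Cre (sep_p (x a) (x a)) + \rsum_b Cre (sep_p (y b) (y b)).
Proof.
move=> B1; rewrite form_sum_sep !sep_pE.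
set Q := smul _ _ _; set q1 := \vsum_a _; set q2 := \vsum_a _.
have : 0 <= F (Q, (/ 2) *r (q1 +v q2)).
  apply: Fpos; exists k, l, x, y, B, (@mzero V N N); split=> //.
  - exact: mcone0.
  - by apply: mat_ext => i j; rewrite /madd /mzero vadd0.
  - move=> v; rewrite qfZ qfD /=.
    have := qf_outer_sum x v; have := qf_outer_sum y v.
    by rewrite -/q1 -/q2 => -> ->; lra.
rewrite F_split; have [fD fZ] := fC_lin; rewrite fZ fD.
rewrite -[fV Q]/(Cre (gV Q)); lra.
Qed.

Let sep_gl v x : clinear (fun y => sep_g v y x).
Proof.
have [gD gZ] := gVL; split=> [y z|a y]; rewrite /sep_g.
  by rewrite -gD; congr gV; apply: mat_ext => i j /=; vlin.
by rewrite -gZ; congr gV; apply: mat_ext => i j /=; vlin.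
Qed.

Let sep_gv y x : clinear (fun v => sep_g v y x).
Proof.
have [gD gZ] := gVL; split=> [v w|a v]; rewrite /sep_g.
  by rewrite -gD; congr gV; apply: mat_ext => i j /=; vlin.
by rewrite -gZ; congr gV; apply: mat_ext => i j /=; vlin.
Qed.

Lemma sep_form : ccp_form sep_p sep_g.
Proof.
have gb1 k l (B : Mat V k l) y x : mnorm B <= 1 ->
    2 * Cre (form_sum sep_g B y x)
    <= \rsum_a Cre (sep_p (x a) (x a)) + \rsum_b Cre (sep_p (y b) (y b)).
  move=> B1.
  have := sep_bound1 (B := mscale (RtoC (- (1))) B) y x.
  have [_ [_ [-> _]]] := nv_norms V k l.
  rewrite (_ : Cabs _ = 1); last first.
    by rewrite /Cabs /Cabs2 /= (_ : _ + _ = 1) ?sqrt_1 //; ring.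
  rewrite (_ : form_sum _ (mscale _ _) _ _ = (- form_sum sep_g B y x)%C).
    have B1' : 1 * mnorm B <= 1 by lra.
    by move=> /= /(_ B1'); lra.
  rewrite !form_sum_sep -(clinearN _ gVL); congr gV.
  rewrite smul_mscale; apply: mat_ext => i j; rewrite /mscale /=; vlin.
split=> //.
- move=> x; have [gD gZ] := gCL; split=> [y z|a y]; rewrite /sep_p.
    by rewrite -gD; congr gC; apply: mat_ext => i j /=; ceq.
  by rewrite -gZ; congr gC; apply: mat_ext => i j /=; ceq.
- move=> x y; rewrite /sep_p -gC_adj; congr gC; apply: mat_ext => i j.
  by rewrite /cadj Cconj_mul CconjK; ceq.
- move=> x; apply: Fpos; apply: (pair_cone_no_norm (mcone0 V N)).
    by apply: mat_ext => i j; rewrite /madd /mstar /= (star0 (nv_starP V)) vadd0.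
  by move=> v; rewrite qf_outer; exact: Cabs2_ge0.
- move=> v y x; rewrite /sep_g -gV_star; congr gV; apply: mat_ext => i j.
  by rewrite /mstar (starZ (nv_starP V)) Cconj_mul CconjK; congr vscale; ring.
- move=> k l B y x; case: (Req_dec (mnorm B) 0) => [B0|Bn0].
    rewrite B0 (mnorm_eq0 B0) /form_sum big1 /= => [|a _]; first lra.
    by rewrite big1 // => b _; apply: (clinear0 (sep_gv _ _)).
  have Bpos : 0 < mnorm B by have := mnorm_ge0 B; lra.
  have Bi : 0 < / mnorm B by apply: Rinv_0_lt_compat.
  have := gb1 k l (mscale (RtoC (/ mnorm B)) B) y x.
  rewrite mnormZ; last lra.
  rewrite Rinv_l //; move=> /(_ (Rle_refl _)).
  rewrite form_sum_sep smul_mscale (_ : mscale _ _ = (/ mnorm B) *r (smul (cadj (x : Mat C k N)) B (y : Mat C l N) : MV)) //.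
  have [_ ->] := gVL; rewrite -form_sum_sep /= => h.
  have {}h := Rmult_le_compat_l _ _ _ (Rlt_le _ _ Bpos) h.
  apply: Rle_trans h; apply: Req_le; field; lra.
- move=> k P x PP; rewrite form_sum_sep.
  have PQ : mcone (smul (cadj (x : Mat C k N)) P (x : Mat C k N)).
    have [_ [_ h]] := nv_ordered V.
    by have := h _ _ (cadj (x : Mat C k N)) P PP; rewrite cadjK.
  apply: Fpos; apply: (pair_cone_no_norm (mconeD PQ PQ)).
    by rewrite (mcone_sa PQ).
  by move=> v; rewrite qf0 /=; lra.
Qed.
End Separation.

(** Evaluate at the standard basis: the sum of the e_i^*e_i is the identity, so F u = 1 becomes
    trace one for [p]; and 1 A 1 = A, so F(A, 0) + c F u <= 0 becomes the last bound. *)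
Lemma exists_separating_form (V : NormalMOStarOpSpace) N (A : Mat V N N) c :
  ~ pair_cone (pair_at A c) ->
  exists (p : funCV 'I_N CCV -> funCV 'I_N CCV -> C) g, 
    [/\ ccp_form (V := V) p g,
        \rsum_i Cre (p (cid_mx N i) (cid_mx N i)) = 1 &
        Cre (form_sum g A (cid_mx N) (cid_mx N)) <= - c].
Proof.
move=> nA.
have [F [FD FZ Fpos F1 FA]] := krein (@pair_coneD V N) (@pair_coneZ V N)
   (pair_cone_unit V N) (@pair_cone_absorbing V N) nA.
have FL : rlinear F by split.
exists (sep_p F), (sep_g F); split; first exact: sep_form.
  rewrite sep_pE // -F1; congr F; congr pair; apply: mat_ext => i j.
  rewrite !vsumE -[RHS](csum_delta i (fun k => cid_mx N k j)).
  apply: eq_bigr => a _; congr Cmul; rewrite /cid_mx eq_sym.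
  by case: eqP => _; ceq.
rewrite form_sum_sep // cadj_cid_mx smul_cid_mx.
rewrite -[Cre _]/(F (A, 0v)).
move: FA; rewrite (_ : pair_at A c = ((A, 0v) : prodCV (matCV V N N) (matCV CCV N N)) +v c *r pair_unit V N).
  by rewrite FD FZ F1; lra.
by rewrite /pair_at; congr pair; apply: mat_ext => i j /=; [vlin|ceq].
Qed.

(** * From a form to matrix-valued maps *)

Lemma affine_ge0_slope a b : (forall t, 0 <= a + t * b) -> b = 0.
Proof.
move=> h; apply: contrapT => b0; have := h (- (a + 1) / b).
by rewrite (_ : _ + _ = - (1)); [lra|field].
Qed.

Section Sesquilinear.
Variables (W : CVSpace) (p : W -> W -> C).
Hypothesis pl : forall x, clinear (fun y => p y x).
Hypothesis pconj : forall x y, p x y = Cconj (p y x).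
Hypothesis ppos : forall x, 0 <= Cre (p x x).

Lemma sesq_Dl x y z : p (x +v y) z = (p x z + p y z)%C.
Proof. by case: (pl z). Qed.
Lemma sesq_Zl a x z : p (a *v x) z = (a * p x z)%C.
Proof. by case: (pl z). Qed.
Lemma sesq_Dr x y z : p z (x +v y) = (p z x + p z y)%C.
Proof. by rewrite pconj sesq_Dl Cconj_add -!pconj. Qed.
Lemma sesq_Zr a x z : p z (a *v x) = (Cconj a * p z x)%C.
Proof. by rewrite pconj sesq_Zl Cconj_mul -pconj. Qed.
Lemma sesq_suml n (F : 'I_n -> W) z :
  p (\vsum_(i < n) F i) z = \csum_(i < n) p (F i) z.
Proof. exact: (clinear_sum _ _ _ (pl z)). Qed.
Lemma sesq_sumr n (F : 'I_n -> W) z :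
  p z (\vsum_(i < n) F i) = \csum_(i < n) p z (F i).
Proof.
by rewrite pconj sesq_suml Cconj_sum; apply: eq_bigr => i _; rewrite -pconj.
Qed.
Lemma sesq_im0 x : Cim (p x x) = 0.
Proof. by have := congr1 Cim (pconj x x) => /=; lra. Qed.

(** For null r the quadratic term of p(x + t r, x + t r) vanishes. What remains is affine in t and
    nonnegative, so its slope 2 Re p(r, x) is zero; i r handles the imaginary part. *)
Lemma sesq_null r x : Cre (p r r) = 0 -> p r x = C0.
Proof.
have re s y : Cre (p s s) = 0 -> Cre (p s y) = 0.
  move=> s0; suff : 2 * Cre (p s y) = 0 by lra.
  apply: (@affine_ge0_slope (Cre (p y y))) => t.
  have := ppos (y +v t *r s).
  rewrite !(sesq_Dl, sesq_Dr, sesq_Zl, sesq_Zr) (pconj y s) /=.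
  by rewrite s0 sesq_im0; lra.
move=> r0; apply: C_ext => /=; first exact: re.
have := re (Ci *v r) x; rewrite !(sesq_Zl, sesq_Zr) /= r0 sesq_im0.
by move=> h; have := h ltac:(ring); lra.
Qed.

(* p may be degenerate: a vector whose residual is p-null adds nothing to b, and
   the expansion of e j holds only modulo p-null vectors. *)
Lemma gram_schmidt (e : nat -> W) n : exists K (b : nat -> W) (c : nat -> nat -> C),
  (forall i j, (i < K)%N -> (j < K)%N -> p (b i) (b j) = if i == j then C1 else C0) /\
  (forall j, (j < n)%N ->
     let r := vsub (e j) (\vsum_(i < K) (c j i *v b i)) in Cre (p r r) = 0).
Proof.
elim: n => [|n [K [b [c [orth null]]]]].
  by exists 0%N, (fun=> 0v), (fun _ _ => C0).
pose w := vsub (e n) (\vsum_(i < K) (p (e n) (b i) *v b i)).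
have wb j : (j < K)%N -> p w (b j) = C0.
  move=> jK; rewrite /w /vsub sesq_Dl voppE sesq_Zl sesq_suml.
  rewrite (bigD1 (Ordinal jK)) //= sesq_Zl orth // eqxx big1; first by ring.
  move=> i ij; rewrite sesq_Zl orth //; have -> : (i == j :> nat) = false by exact: negbTE.
  by ring.
case: (Req_dec (Cre (p w w)) 0) => [w0|wn0].
  exists K, b, (fun j i => if j == n then p (e n) (b i) else c j i); split=> //.
  move=> j; rewrite ltnS leq_eqVlt => /orP[/eqP ->|jn] /=.
    by rewrite eqxx.
  by rewrite (ltn_eqF jn); exact: null.
have wpos : 0 < Cre (p w w) by have := ppos w; lra.
pose d := sqrt (Cre (p w w)).
have d0 : 0 < d by apply: sqrt_lt_R0.
have d2 : d * d = Cre (p w w) by rewrite sqrt_sqrt //; lra.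
pose b' i := if (i < K)%N then b i else (/ d) *r w.
exists K.+1, b', (fun j i => if j == n then (if (i < K)%N then p (e n) (b i) else RtoC d)
                        else (if (i < K)%N then c j i else C0)).
split.
  move=> i j; rewrite !ltnS /b' => iK jK.
  case: (ltnP i K) => iK'; case: (ltnP j K) => jK'.
  - exact: orth.
  - rewrite sesq_Zr pconj wb // ltn_eqF; last exact: leq_trans jK'.
    by ceq.
  - by rewrite sesq_Zl wb // gtn_eqF; [ceq|exact: leq_trans iK'].
  - have -> : i == j by rewrite (@anti_leq i j) ?eqxx // (leq_trans iK jK') (leq_trans jK iK').
    rewrite sesq_Zl sesq_Zr; apply: C_ext; rewrite /= sesq_im0 -?d2; field; lra.
move=> j; rewrite ltnS leq_eqVlt => /orP[/eqP ->|jn] /=.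
  rewrite eqxx big_ord_recr /= /b' ltnn.
  rewrite (_ : vsub _ _ = 0v); first by rewrite -(vscale0 (0v : W)) sesq_Zl /=; ring.
  rewrite (eq_bigr (fun i : 'I_K => p (e n) (b i) *v b i)) => [|i _]; last first.
    by rewrite ltn_ord.
  set S := (X in vsub _ (X +v _)); have -> : w = vsub (e n) S by [].
  by vlin.
rewrite (ltn_eqF jn) big_ord_recr /= /b' ltnn vscale0 vadd0.
under eq_bigr do rewrite ltn_ord.
exact: null.
Qed.
End Sesquilinear.

Definition fam_sqnorm n K (x : 'I_n -> 'I_K -> C) : R := \rsum_a sqnorm (x a).
Definition fam_dot n K (x y : 'I_n -> 'I_K -> C) : C := \csum_a dot (x a) (y a).

Definition block_act (V : CVSpace) K (psi : V -> 'I_K -> 'I_K -> C) n m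
    (A : Mat V n m) (y : 'I_m -> 'I_K -> C) : 'I_n -> 'I_K -> C :=
  fun a i => \csum_b \csum_j (psi (A a b) i j * y b j).

Record ccp_block (V : NormalMOStarOpSpace) K (psi : V -> 'I_K -> 'I_K -> C) : Prop := {
  block_lin : forall i j, clinear (fun v => psi v i j);
  block_star : forall v i j, psi (vstar v) i j = Cconj (psi v j i);
  block_bound : forall n m (A : Mat V n m) y,
    fam_sqnorm (block_act psi A y) <= mnorm A * mnorm A * fam_sqnorm y;
  block_pos : forall n (P : Mat V n n) x, mcone P -> 0 <= Cre (fam_dot (block_act psi P x) x)
}.

Section FormToBlock.
Variables (V : NormalMOStarOpSpace) (W : CVSpace).
Variables (p : W -> W -> C) (g : V -> W -> W -> C).
Hypothesis pg : ccp_form p g.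

Let pl := form_pl pg.
Let pconj := form_pconj pg.
Let ppos := form_ppos pg.

Lemma form_gr v y x : g v y x = Cconj (g (vstar v) x y).
Proof. by rewrite -(form_gstar pg) (starK (nv_starP V)). Qed.

Lemma form_sumDl k l (B : Mat V k l) y y' x :
  form_sum g B (fun b => y b +v y' b) x = (form_sum g B y x + form_sum g B y' x)%C.
Proof.
rewrite /form_sum -big_split; apply: eq_bigr => a _; rewrite -big_split.
by apply: eq_bigr => b _; case: (form_gl pg (B a b) (x a)).
Qed.

Lemma form_sum_star k l (B : Mat V k l) y x :
  form_sum g B y x = Cconj (form_sum g (mstar (@vstar V) B) x y).
Proof.
rewrite /form_sum Cconj_sum; under [RHS]eq_bigr do rewrite Cconj_sum.
rewrite exchange_big; apply: eq_bigr => a _; apply: eq_bigr => b _.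
exact: form_gr.
Qed.

Lemma form_sumDr k l (B : Mat V k l) y x x' :
  form_sum g B y (fun a => x a +v x' a) = (form_sum g B y x + form_sum g B y x')%C.
Proof. by rewrite form_sum_star form_sumDl Cconj_add -!form_sum_star. Qed.

Lemma form_sumZl k l (B : Mat V k l) c y x :
  form_sum g B (fun b => c *v y b) x = (c * form_sum g B y x)%C.
Proof.
rewrite /form_sum Cmul_suml; apply: eq_bigr => a _; rewrite Cmul_suml.
by apply: eq_bigr => b _; case: (form_gl pg (B a b) (x a)).
Qed.

(** Scaling a null [y] by t multiplies the left side of [form_gbound] by t and leaves the right side
    fixed. *)
Lemma form_sum_nulll k l (B : Mat V k l) y x :
  (forall b, Cre (p (y b) (y b)) = 0) -> Cre (form_sum g B y x) = 0.
Proof.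
move=> y0; suff : - (2 * Cre (form_sum g B y x)) = 0 by lra.
apply: (@affine_ge0_slope (mnorm B * \rsum_a Cre (p (x a) (x a)))) => t.
have := form_gbound pg B (fun b => t *r y b) x.
rewrite form_sumZl [X in _ * (_ + X)]big1 /= => [|b _]; first lra.
by rewrite (sesq_Zl pl) (sesq_Zr pl pconj) /= y0 (sesq_im0 pconj); ring.
Qed.

Lemma form_sum_nullr k l (B : Mat V k l) y x :
  (forall a, Cre (p (x a) (x a)) = 0) -> Cre (form_sum g B y x) = 0.
Proof. by move=> x0; rewrite form_sum_star /= form_sum_nulll. Qed.

Variables (K : nat) (b : nat -> W).
Hypothesis orth : forall i j, (i < K)%N -> (j < K)%N ->
  p (b i) (b j) = if i == j then C1 else C0.

Definition comb (x : 'I_K -> C) : W := \vsum_(i < K) (x i *v b i).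

(** The indices are swapped because [g v] is linear in its first slot, which is the column index. *)
Definition compression (v : V) (i j : 'I_K) : C := g v (b j) (b i).

Lemma comb_form v y x :
  g v (comb y) (comb x)
  = \csum_i ((\csum_j (compression v i j * y j)) * Cconj (x i)).
Proof.
have gr z : g v z (comb x) = \csum_(i < K) (g v z (b i) * Cconj (x i)).
  rewrite form_gr (clinear_sum _ _ _ (form_gl pg _ _)) Cconj_sum.
  apply: eq_bigr => i _; have [_ ->] := form_gl pg (vstar v) z.
  by rewrite Cconj_mul -form_gr; ring.
rewrite gr; apply: eq_bigr => i _; congr Cmul.
rewrite (clinear_sum _ _ _ (form_gl pg _ _)).
apply: eq_bigr => j _; have [_ ->] := form_gl pg v (b i).
by rewrite /compression; ring.
Qed.

Lemma comb_p x : Cre (p (comb x) (comb x)) = sqnorm x.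
Proof.
rewrite (sesq_suml pl) Cre_sum; apply: eq_bigr => i _.
rewrite (sesq_Zl pl) (sesq_sumr pl pconj) (bigD1 i) //= big1 => [|j /negbTE ij].
  rewrite (sesq_Zr pl pconj) orth // eqxx /Cabs2 /=; ring.
by rewrite (sesq_Zr pl pconj) orth // eq_sym val_eqE ij; ring.
Qed.

Lemma comb_form_sum k l (B : Mat V k l) y x :
  form_sum g B (fun c => comb (y c)) (fun a => comb (x a))
  = fam_dot (block_act compression B y) x.
Proof.
apply: eq_bigr => a _; under eq_bigr do rewrite comb_form.
rewrite exchange_big; apply: eq_bigr => i _ /=.
by rewrite /block_act Cmul_sumr.
Qed.

(** For the bound, test the arithmetic-geometric estimate at x = t z, where z is the image of y. The
    optimal t = 1/|A| gives |z|^2 <= |A|^2 |y|^2; for |A| = 0 the choice t = 1 gives z = 0. *)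
Lemma compression_block : ccp_block compression.
Proof.
split.
- by move=> i j; exact: (form_gv pg).
- by move=> v i j; exact: (form_gstar pg).
- move=> n m A y.
  have key x : 2 * Cre (fam_dot (block_act compression A y) x) <= mnorm A * (fam_sqnorm x + fam_sqnorm y).
    rewrite -comb_form_sum; apply: Rle_trans (form_gbound pg _ _ _) _.
    by apply: Req_le; congr (_ * (_ + _)); apply: eq_bigr => i _; exact: comb_p.
  set z := block_act _ _ _ in key *.
  have kt t : 2 * t * fam_sqnorm z <= mnorm A * (t * t * fam_sqnorm z + fam_sqnorm y).
    have := key (fun a i => RtoC t * z a i)%C.
    rewrite (_ : Cre (fam_dot _ _) = t * fam_sqnorm z); last first.
      rewrite /fam_dot Cre_sum /fam_sqnorm Rmul_suml; apply: eq_bigr => a _.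
      rewrite (_ : dot _ _ = RtoC t * dot (z a) (z a))%C.
        by rewrite dot_sqnorm /=; ring.
      rewrite /dot Cmul_suml; apply: eq_bigr => i _.
      by rewrite Cconj_mul Cconj_RtoC; ring.
    rewrite (_ : fam_sqnorm (fun a i => RtoC t * z a i)%C = t * t * fam_sqnorm z); first lra.
    rewrite /fam_sqnorm Rmul_suml; apply: eq_bigr => a _; rewrite sqnormZ /Cabs2 /=; ring.
  have [A0|A0] : 0 < mnorm A \/ mnorm A = 0 by have := mnorm_ge0 A; lra.
    have Ai : mnorm A * / mnorm A = 1 by field; lra.
    have := Rmult_le_compat_l _ _ _ (Rlt_le _ _ A0) (kt (/ mnorm A)).
    move: (/ mnorm A) Ai => s Ai.
    have -> : mnorm A * (2 * s * fam_sqnorm z) = 2 * (mnorm A * s) * fam_sqnorm z by ring.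
    have -> : mnorm A * (mnorm A * (s * s * fam_sqnorm z + fam_sqnorm y)) =
      (mnorm A * s) * (mnorm A * s) * fam_sqnorm z + mnorm A * mnorm A * fam_sqnorm y by ring.
    by rewrite Ai; lra.
  by have := kt 1; rewrite A0; lra.
- by move=> n P x PP; rewrite -comb_form_sum; exact: (form_gpos pg).
Qed.
End FormToBlock.

(** Each standard basis vector is a combination of the orthonormal family plus a null vector. Null
    vectors drop out of both [p] and [g], so the coefficients [e] inherit the trace 1 and the bound
    - c. *)
Lemma exists_block (V : NormalMOStarOpSpace) N (A : Mat V N N) c :
  ~ pair_cone (pair_at A c) ->
  exists K (psi : V -> 'I_K -> 'I_K -> C) e,
    [/\ ccp_block psi, fam_sqnorm e <= 1 & Cre (fam_dot (block_act psi A e) e) <= - c].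
Proof.
move=> /exists_separating_form[p [g [pg p1 gA]]].
pose W := funCV 'I_N CCV.
pose E (k : nat) : W := fun j : 'I_N => if k == j then C1 else C0.
have EE (i : 'I_N) : E i = cid_mx N i by apply: funext => j; rewrite /E val_eqE.
have [K [b [c' [orth null]]]] :=
  gram_schmidt (form_pl pg) (form_pconj pg) (form_ppos pg) E N.
pose e (j : 'I_N) (i : 'I_K) := c' j i.
have [r [r0 dec]] : exists r : 'I_N -> W, (forall j, Cre (p (r j) (r j)) = 0) /\
    (cid_mx N : 'I_N -> W) = fun j => comb b (e j) +v r j.
  exists (fun j => vsub (cid_mx N j : W) (comb b (e j))); split=> [j|].
    by rewrite -EE; exact: null.
  by apply: funext => j; vlin.
exists K, (compression g b), e; split.
- exact: (@compression_block _ _ _ _ pg _ _ orth).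
- rewrite -p1 /fam_sqnorm; apply: Req_le; apply: eq_bigr => j _.
  rewrite -(comb_p pg orth) (congr1 (fun f => f j) dec).
  rewrite !(sesq_Dl (form_pl pg)) !(sesq_Dr (form_pl pg) (form_pconj pg)).
  have rn := sesq_null (form_pl pg) (form_pconj pg) (form_ppos pg) _ (r0 j).
  by rewrite (form_pconj pg (comb _ _) (r j)) !rn /=; ring.
rewrite -(@comb_form_sum _ _ _ _ pg); move: gA; rewrite {1 2}dec.
rewrite (form_sumDl pg) !(form_sumDr pg) /=.
set u := fun j => comb b (e j).
have ur : Cre (form_sum g A u r) = 0 by apply: (form_sum_nullr pg).
have ru : Cre (form_sum g A r u) = 0 by apply: (form_sum_nulll pg).
have rr : Cre (form_sum g A r r) = 0 by apply: (form_sum_nulll pg).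
by lra.
Qed.

(** * Hilbert sums *)

Section UnorderedSum.
Variable S : eqType.
Implicit Types (l : seq S) (g h : S -> R).

Definition psum l g : R := \big[Rplus/R0]_(s <- l) g s.

(** Convergence along the net of finite subsets: the index type will be that of all blocks, for
    which no enumeration is available. *)
Definition has_sum g (sigma : R) := forall eps, 0 < eps ->
  exists2 l0, uniq l0 &
    forall l, uniq l -> {subset l0 <= l} -> Rabs (psum l g - sigma) < eps.

Lemma psumD l g h : psum l (fun s => g s + h s) = psum l g + psum l h.
Proof. by rewrite /psum big_split. Qed.

Lemma psumZ l a g : psum l (fun s => a * g s) = a * psum l g.
Proof. by rewrite /psum Rmul_suml. Qed.

Lemma psum_le l g h : (forall s, g s <= h s) -> psum l g <= psum l h.
Proof. by move=> gh; apply: Rsum_le. Qed.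

Lemma psum_sub l0 l g : (forall s, 0 <= g s) -> uniq l0 -> uniq l ->
  {subset l0 <= l} -> psum l0 g <= psum l g.
Proof.
move=> g0 u0 u sub.
have pe : perm_eq l0 [seq s <- l | s \in l0].
  apply: uniq_perm; rewrite ?filter_uniq // => s; rewrite mem_filter.
  by case: (boolP (s \in l0)) => //= /sub ->.
rewrite /psum (perm_big _ pe) big_filter (bigID (fun s => s \in l0) xpredT) /=.
have : 0 <= \big[Rplus/R0]_(i <- l | i \notin l0) g i by exact: Rsum_ge0.
by lra.
Qed.

Lemma has_sum_unique g s t : has_sum g s -> has_sum g t -> s = t.
Proof.
move=> hs ht; apply: cond_eq => eps e0.
have [l1 u1 h1] := hs (eps / 2) ltac:(lra).
have [l2 u2 h2] := ht (eps / 2) ltac:(lra).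
have s1 : {subset l1 <= undup (l1 ++ l2)}.
  by move=> x; rewrite mem_undup mem_cat => ->.
have s2 : {subset l2 <= undup (l1 ++ l2)}.
  by move=> x; rewrite mem_undup mem_cat orbC => ->.
have := h1 _ (undup_uniq _) s1; have := h2 _ (undup_uniq _) s2.
by move: (psum _ _) => z; split_Rabs; lra.
Qed.

Lemma has_sumD g h s t :
  has_sum g s -> has_sum h t -> has_sum (fun x => g x + h x) (s + t).
Proof.
move=> hs ht eps e0.
have [l1 u1 h1] := hs (eps / 2) ltac:(lra).
have [l2 u2 h2] := ht (eps / 2) ltac:(lra).
exists (undup (l1 ++ l2)); first exact: undup_uniq.
move=> l ul sub; rewrite psumD.
have s1 : {subset l1 <= l} by move=> x xl; apply: sub; rewrite mem_undup mem_cat xl.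
have s2 : {subset l2 <= l} by move=> x xl; apply: sub; rewrite mem_undup mem_cat xl orbT.
have := h1 _ ul s1; have := h2 _ ul s2; split_Rabs; lra.
Qed.

Lemma has_sumZ a g s : has_sum g s -> has_sum (fun x => a * g x) (a * s).
Proof.
move=> hs eps e0; have a1 : 0 < Rabs a + 1 by have := Rabs_pos a; lra.
have [l0 u0 h0] := hs (eps / (Rabs a + 1)) (Rdiv_lt_0_compat _ _ e0 a1).
exists l0 => // l ul sub; rewrite psumZ -Rmult_minus_distr_l Rabs_mult.
have {}h0 := h0 _ ul sub.
have := Rmult_lt_compat_l _ _ _ a1 h0.
rewrite (_ : (Rabs a + 1) * (eps / (Rabs a + 1)) = eps); last by field; lra.
by have := Rabs_pos (psum l g - s); have := Rabs_pos a; nra.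
Qed.

Lemma has_sum0 : has_sum (fun=> 0) 0.
Proof.
move=> eps e0; exists nil => // l _ _; rewrite /psum big1 // Rminus_0_r Rabs_R0 //.
Qed.

Lemma has_sum_big n (g : 'I_n -> S -> R) s :
  (forall a, has_sum (g a) (s a)) ->
  has_sum (fun x => \rsum_(a < n) g a x) (\rsum_(a < n) s a).
Proof.
move=> h; rewrite (_ : (fun x => _) = \big[(fun f g x => f x + g x)/(fun=> 0)]_(a < n) g a).
  elim/big_rec2: _ => [|a f t _ ft]; first exact: has_sum0.
  exact: has_sumD.
apply: funext => x.
by apply/esym; apply: (big_morph (fun f : S -> R => f x)).
Qed.

Lemma has_sum_ge_psum g s l : (forall x, 0 <= g x) -> has_sum g s -> uniq l ->
  psum l g <= s.
Proof.
move=> g0 hs ul; apply: Rnot_lt_le => lt.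
have [l0 u0 h0] := hs (psum l g - s) ltac:(lra).
have s1 : {subset l0 <= undup (l0 ++ l)}.
  by move=> x; rewrite mem_undup mem_cat => ->.
have s2 : {subset l <= undup (l0 ++ l)}.
  by move=> x; rewrite mem_undup mem_cat orbC => ->.
have := h0 _ (undup_uniq _) s1; have := psum_sub g0 ul (undup_uniq _) s2.
by split_Rabs; lra.
Qed.

Lemma has_sum_le_bound g s M : has_sum g s ->
  (forall l, uniq l -> psum l g <= M) -> s <= M.
Proof.
move=> hs h; apply: Rnot_lt_le => lt.
have [l0 u0 h0] := hs (s - M) ltac:(lra).
by have := h0 _ u0 (fun x xl => xl); have := h _ u0; split_Rabs; lra.
Qed.

Lemma has_sum_ge0 g s : (forall x, 0 <= g x) -> has_sum g s -> 0 <= s.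
Proof.
move=> g0 hs; have := @has_sum_ge_psum g s nil g0 hs isT.
by rewrite /psum big_nil.
Qed.

Lemma has_sum_le g h s t : (forall x, g x <= h x) -> has_sum g s -> has_sum h t ->
  s <= t.
Proof.
move=> gh hs ht; have gh0 x : 0 <= h x + (- (1)) * g x by have := gh x; lra.
have := has_sum_ge0 gh0 (has_sumD ht (has_sumZ (- (1)) hs)); lra.
Qed.

Lemma has_sum_ex g M : (forall x, 0 <= g x) ->
  (forall l, uniq l -> psum l g <= M) -> exists s, has_sum g s.
Proof.
move=> g0 h.
have ub : is_upper_bound (fun r => exists2 l, uniq l & r = psum l g) M.
  by move=> _ [l ul ->]; exact: h.
have [s [sub slub]] := completeness _ (ex_intro _ M ub)
  (ex_intro _ _ (ex_intro2 _ _ (nil : seq S) isT erefl)).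
exists s => eps e0.
have [l0 u0 h0] : exists2 l0, uniq l0 & s - eps < psum l0 g.
  apply: contrapT => no.
  have : s <= s - eps; last lra.
  apply: slub => _ [l ul ->]; apply: Rnot_lt_le => lt; apply: no.
  by exists l.
exists l0 => // l ul sl.
have := psum_sub g0 u0 ul sl.
have : psum l g <= s by apply: sub; exists l.
by split_Rabs; lra.
Qed.

Lemma has_sum_ex_le g h t : (forall x, 0 <= g x <= h x) -> has_sum h t ->
  exists s, has_sum g s.
Proof.
move=> gh ht; apply: (@has_sum_ex g t) => [x|l ul]; first by case: (gh x).
apply: Rle_trans (psum_le l (fun x => proj2 (gh x))) _.
by apply: has_sum_ge_psum => // x; have := gh x; lra.
Qed.

Lemma has_sum_single g s0 : (forall s, s != s0 -> g s = 0) -> has_sum g (g s0).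
Proof.
move=> h eps e0; exists [:: s0] => // l ul sub.
rewrite /psum (bigD1_seq s0) ?sub ?mem_head //= big1 => [|s]; last exact: h.
by rewrite Rplus_0_r Rminus_diag_eq // Rabs_R0.
Qed.

(** The default 0 makes the inner product total, so that convergence can be proved after it is
    defined. *)
Definition tsum g : R :=
  if pselect (exists s, has_sum g s) is left h then projT1 (cid h) else 0.

Lemma tsumP g : (exists s, has_sum g s) -> has_sum g (tsum g).
Proof. by rewrite /tsum; case: pselect => // h _; exact: (projT2 (cid h)). Qed.
End UnorderedSum.

Lemma Un_cv_sum I (r : seq I) (F : I -> nat -> R) (l : I -> R) :
  (forall i, Un_cv (F i) (l i)) ->
  Un_cv (fun q => \big[Rplus/R0]_(i <- r) F i q) (\big[Rplus/R0]_(i <- r) l i).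
Proof.
move=> h; elim: r => [|i r IH].
  rewrite big_nil => eps e0; exists 0%N => n _.
  by rewrite big_nil /Rdist Rminus_0_r Rabs_R0.
rewrite big_cons; have := CV_plus _ _ _ _ (h i) IH.
by move=> H eps /H[n Hn]; exists n => m /Hn; rewrite big_cons.
Qed.

(** * The l2-sum of a family of finite-dimensional spaces *)

Section L2Sum.
Variables (S : eqType) (K : S -> nat).

Definition l2fun := forall s, 'I_(K s) -> C.

Record l2vec := L2Vec {
  l2val :> forall s, 'I_(K s) -> C;
  l2P : exists t, has_sum (fun s => sqnorm (@l2val s)) t
}.
Arguments l2val : clear implicits.

Lemma l2_ext (x y : l2vec) : (forall s i, x s i = y s i) -> x = y.
Proof.
case: x y => [x xP] [y yP] /= h.
have e : x = y by apply: functional_extensionality_dep => s; apply: funext.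
by case: _ / e yP => yP; congr L2Vec; apply: Prop_irrelevance.
Qed.

Lemma sqnormD_le (T : finType) (x y : T -> C) :
  sqnorm (fun i => x i + y i)%C <= 2 * sqnorm x + 2 * sqnorm y.
Proof.
rewrite /sqnorm !Rmul_suml -big_split; apply: Rsum_le => i _ /=.
rewrite /Cabs2; case: (x i) (y i) => a b [c d] /=.
by have := Rle_0_sqr (a - c); have := Rle_0_sqr (b - d); rewrite /Rsqr; lra.
Qed.

Lemma l2_add_subproof (x y : l2vec) :
  exists t, has_sum (fun s => sqnorm (fun i => x s i + y s i)%C) t.
Proof.
have [t ht] := l2P x; have [u hu] := l2P y.
apply: has_sum_ex_le (has_sumD (has_sumZ 2 ht) (has_sumZ 2 hu)) => s.
by split; [exact: sqnorm_ge0|exact: sqnormD_le].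
Qed.
Definition l2_add x y := L2Vec (l2_add_subproof x y).

Lemma l2_scale_subproof a (x : l2vec) :
  exists t, has_sum (fun s => sqnorm (fun i => a * x s i)%C) t.
Proof.
have [t ht] := l2P x; exists (Cabs2 a * t).
by under eq_fun do rewrite sqnormZ; exact: has_sumZ.
Qed.
Definition l2_scale a x := L2Vec (l2_scale_subproof a x).

Lemma l2_zero_subproof :
  exists t, has_sum (fun s => sqnorm (fun _ : 'I_(K s) => C0)) t.
Proof.
exists 0; rewrite (_ : (fun s => _) = (fun=> 0)); first exact: has_sum0.
by apply: funext => s; rewrite /sqnorm big1 // => i _; rewrite /Cabs2 /=; ring.
Qed.
Definition l2_zero := L2Vec l2_zero_subproof.

Definition l2CV : CVSpace.
refine {| cvs_car := l2vec; vzero := l2_zero; vadd := l2_add;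
  vopp := l2_scale (- (1))%C; vscale := l2_scale |};
  abstract (move=> *; apply: l2_ext => s i /=; ring).
Defined.

Definition l2_ip (x y : l2vec) : C :=
  mkC (tsum (fun s => Cre (dot (x s) (y s)))) (tsum (fun s => Cim (dot (x s) (y s)))).

Lemma sqnorm_polar (T : finType) (x y : T -> C) :
  sqnorm (fun i => x i + y i)%C = sqnorm x + sqnorm y + 2 * Cre (dot x y).
Proof.
rewrite /sqnorm /dot Cre_sum Rmul_suml -!big_split; apply: eq_bigr => i _ /=.
by rewrite /Cabs2 /=; ring.
Qed.

(** Polarisation writes the terms through the squared norms of x, y and x + y, all of which are
    summable. *)
Lemma l2_ip_re (x y : l2vec) : has_sum (fun s => Cre (dot (x s) (y s))) (Cre (l2_ip x y)).
Proof.
apply: tsumP; have [t ht] := l2P x; have [u hu] := l2P y.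
have [w hw] := l2P (l2_add x y).
exists (/ 2 * (w + (- (1)) * (t + u))).
rewrite (_ : (fun s => _) = fun s => / 2 * (sqnorm (l2_add x y s) +
    (- (1)) * (sqnorm (x s) + sqnorm (y s)))); last first.
  by apply: funext => s; rewrite sqnorm_polar; field.
by apply/has_sumZ/has_sumD => //; apply/has_sumZ/has_sumD.
Qed.

Lemma l2_ip_im (x y : l2vec) : has_sum (fun s => Cim (dot (x s) (y s))) (Cim (l2_ip x y)).
Proof.
apply: tsumP; exists (Cre (l2_ip x (l2_scale Ci y))).
rewrite (_ : (fun s => _) = fun s => Cre (dot (x s) (l2_scale Ci y s))).
  exact: l2_ip_re.
apply: funext => s; rewrite /dot Cre_sum Cim_sum; apply: eq_bigr => i _ /=; ring.
Qed.

Lemma l2_ip_eq (x y : l2vec) z : has_sum (fun s => Cre (dot (x s) (y s))) (Cre z) ->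
  has_sum (fun s => Cim (dot (x s) (y s))) (Cim z) -> l2_ip x y = z.
Proof.
by move=> hr hi; apply: C_ext;
  [apply: has_sum_unique hr; exact: l2_ip_re|apply: has_sum_unique hi; exact: l2_ip_im].
Qed.

Lemma l2_sqnorm (x : l2vec) : has_sum (fun s => sqnorm (x s)) (Cre (l2_ip x x)).
Proof.
rewrite (_ : (fun s => _) = fun s => Cre (dot (x s) (x s))); first exact: l2_ip_re.
by apply: funext => s; rewrite dot_sqnorm.
Qed.

Lemma Cabs2_le_sqnorm (T : finType) (x : T -> C) i : Cabs2 (x i) <= sqnorm x.
Proof.
rewrite /sqnorm (bigD1 i) //=.
have : 0 <= \big[Rplus/R0]_(j | j != i) Cabs2 (x j).
  by apply: Rsum_ge0 => j _; exact: Cabs2_ge0.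
by lra.
Qed.

Lemma sqnorm_le_ip (x : l2vec) s : sqnorm (x s) <= Cre (l2_ip x x).
Proof.
have := @has_sum_ge_psum _ _ _ [:: s] (fun s => sqnorm_ge0 (x s)) (l2_sqnorm x) isT.
by rewrite /psum big_seq1.
Qed.

(** The limit is taken coordinatewise. On each finite index set the Cauchy bound passes to this
    limit, with a constant independent of the set, and hence to the whole sum. *)
Lemma l2_complete (u : nat -> l2CV) :
  (forall eps, 0 < eps -> exists N, forall p q, (N <= p)%N -> (N <= q)%N ->
      ipnorm (V := l2CV) l2_ip (vsub (u p) (u q)) < eps) ->
  exists l, forall eps, 0 < eps -> exists N, forall p, (N <= p)%N ->
      ipnorm (V := l2CV) l2_ip (vsub (u p) l) < eps.
Proof.
move=> cau.
have sqlt a eps : 0 <= a -> 0 < eps -> sqrt a < eps -> a < eps * eps.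
  move=> a0 e0 h; rewrite -[a]sqrt_sqrt //; have := sqrt_pos a; nra.
(* Defined on arbitrary families, as the limit is not yet known to be square summable. *)
pose D (x y : l2fun) s : R := sqnorm (fun i => x s i + - y s i)%C.
have De (x y : l2CV) : (fun s => sqnorm ((vsub x y : l2vec) s)) = D x y.
  by apply: funext => s; apply: eq_bigr => i _ /=; congr Cabs2; ring.
have cau2 eps : 0 < eps -> exists N, forall p q, (N <= p)%N -> (N <= q)%N ->
    forall l, uniq l -> psum l (D (u p) (u q)) <= eps * eps.
  move=> e0; have [N hN] := cau eps e0; exists N => p q Np Nq l ul.
  rewrite -De; apply: Rle_trans (has_sum_ge_psum (fun s => sqnorm_ge0 _) (l2_sqnorm _) ul) _.
  apply: Rlt_le; apply: sqlt => //; last exact: hN.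
  by apply: Rle_trans (has_sum_ge0 (fun s => sqnorm_ge0 _) (l2_sqnorm _)); lra.
have entry eps : 0 < eps -> exists N, forall p q, (N <= p)%N -> (N <= q)%N ->
    forall s i, Cabs2 (u p s i + - u q s i) <= eps * eps.
  move=> e0; have [N hN] := cau2 _ e0; exists N => p q Np Nq s i.
  have := hN p q Np Nq [:: s] isT; rewrite /psum big_seq1.
  by apply: Rle_trans; exact: (@Cabs2_le_sqnorm _ (fun i => u p s i + - u q s i)%C).
have lim (pr : C -> R) : (forall z w, Rabs (pr z - pr w) * Rabs (pr z - pr w)
      <= Cabs2 (z + - w)) ->
    exists f : forall s, 'I_(K s) -> R, forall s i, Un_cv (fun q => pr (u q s i)) (f s i).
  move=> prle.
  (* Packing s and i into one index lets a single use of choice produce the dependent family of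
     limits. *)
  have hl (si : {s : S & 'I_(K s)}) :
      exists l, Un_cv (fun q => pr (u q (projT1 si) (projT2 si))) l.
    case: si => s i /=.
    have [|l hl] := R_complete (fun q => pr (u q s i)); last by exists l.
    move=> eps e0; have [N hN] := entry (eps / 2) ltac:(lra).
    exists N => p q /leP Np /leP Nq; rewrite /Rdist.
    have := hN p q Np Nq s i; have := prle (u p s i) (u q s i).
    by have := Rabs_pos (pr (u p s i) - pr (u q s i)); nra.
  have [f fP] := boolp.choice hl.
  by exists (fun s i => f (existT _ s i)) => s i; exact: (fP (existT _ s i)).
have [fr frP] : exists f : forall s, 'I_(K s) -> R,
    forall s i, Un_cv (fun q => Cre (u q s i)) (f s i).
  apply: lim => z w; rewrite -Rabs_mult Rabs_pos_eq; last exact: Rle_0_sqr.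
  by rewrite /Cabs2 /=; have := Rle_0_sqr (Cim z - Cim w); rewrite /Rsqr; lra.
have [fi fiP] : exists f : forall s, 'I_(K s) -> R,
    forall s i, Un_cv (fun q => Cim (u q s i)) (f s i).
  apply: lim => z w; rewrite -Rabs_mult Rabs_pos_eq; last exact: Rle_0_sqr.
  by rewrite /Cabs2 /=; have := Rle_0_sqr (Cre z - Cre w); rewrite /Rsqr; lra.
pose f : l2fun := fun s i => mkC (fr s i) (fi s i).
have cst0 (v : nat -> R) l : Un_cv v l -> Un_cv (fun q => v q + - l) 0.
  move=> h eps /h[N hN]; exists N => n /hN.
  by rewrite /Rdist Rminus_0_r.
have Dlim l : Un_cv (fun q => psum l (D (u q) f)) 0.
  rewrite -[X in Un_cv _ X](_ : \big[Rplus/R0]_(s <- l) 0 = 0); last by rewrite big1.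
  apply: Un_cv_sum => s.
  rewrite -[X in Un_cv _ X](_ : \big[Rplus/R0]_(i < K s) 0 = 0); last by rewrite big1.
  apply: Un_cv_sum => i; rewrite /Cabs2 /=.
  rewrite -[X in Un_cv _ X](_ : 0 * 0 + 0 * 0 = 0); last by ring.
  by apply: CV_plus; apply: CV_mult; apply: cst0.
have Dbound p eps N : 0 < eps -> (N <= p)%N ->
    (forall q, (N <= q)%N -> forall l, uniq l -> psum l (D (u p) (u q)) <= eps * eps) ->
    forall l, uniq l -> psum l (D (u p) f) <= 4 * (eps * eps).
  move=> e0 Np h l ul.
  (* [Q] depends on the finite set [l], but the resulting bound 2 eps^2 + 2 eps^2 does not. *)
  have [Q hQ] := Dlim l (eps * eps) ltac:(nra).
  have := hQ (maxn N Q); rewrite /Rdist Rminus_0_r => /(_ _)/Rabs_def2 [].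
    by apply/leP; rewrite leq_maxr.
  set q := maxn N Q => h1 _; have h2 := h q (leq_maxl _ _) l ul.
  have : psum l (D (u p) f) <= psum l (fun s => 2 * D (u p) (u q) s + 2 * D (u q) f s).
    apply: psum_le => s; apply: Rle_trans (sqnormD_le _ _).
    by apply: Req_le; apply: eq_bigr => i _; congr Cabs2; ring.
  by rewrite psumD !psumZ; lra.
have fP : exists t, has_sum (fun s => sqnorm (f s)) t.
  have [N hN] := cau2 1 ltac:(lra).
  have hb := @Dbound N 1 N ltac:(lra) (leqnn _) (fun q Nq => hN N q (leqnn _) Nq).
  have [t ht] := @has_sum_ex _ _ _ (fun s => sqnorm_ge0 _) hb.
  have [v hv] := l2P (u N).
  apply: has_sum_ex_le (has_sumD (has_sumZ 2 hv) (has_sumZ 2 ht)) => s.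
  split; first exact: sqnorm_ge0.
  have e : D (u N) f s = sqnorm (fun i => - (1) * (u N s i + - f s i))%C.
    rewrite sqnormZ (_ : Cabs2 (- (1))%C = 1) ?Rmult_1_l //.
    by rewrite /Cabs2 /=; ring.
  suff : sqnorm (f s) <= 2 * sqnorm (u N s) + 2 * D (u N) f s by [].
  rewrite e; apply: Rle_trans (sqnormD_le _ _).
  by apply: Req_le; apply: eq_bigr => i _; congr Cabs2; ring.
exists (L2Vec fP : l2CV) => eps e0.
(* The factor 4 of [Dbound] turns this into (eps/2)^2, which leaves room for the strict
   inequality. *)
have [N hN] := cau2 (eps / 4) ltac:(lra).
exists N => p Np; rewrite /ipnorm.
have hb := @Dbound p (eps / 4) N ltac:(lra) Np (fun q Nq => hN p q Np Nq).
have le : Cre (l2_ip (vsub (u p) (L2Vec fP : l2CV)) (vsub (u p) (L2Vec fP : l2CV)))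
    <= 4 * (eps / 4 * (eps / 4)).
  by apply: (has_sum_le_bound (l2_sqnorm _)); rewrite De.
apply: Rle_lt_trans (sqrt_le_1_alt _ _ le) _.
rewrite (_ : 4 * _ = (eps / 2) * (eps / 2)); last by field.
by rewrite sqrt_square; lra.
Qed.

Definition l2Hilbert : HilbertSpace.
refine {| hs_vs := l2CV; ip := l2_ip; hs_complete := l2_complete |}.
- abstract (move=> x y z; apply: l2_ip_eq => /=;
    [rewrite (_ : (fun s => _) = fun s => Cre (dot (x s) (z s)) + Cre (dot (y s) (z s)));
      [by apply: has_sumD; exact: l2_ip_re
      |by apply: funext => s; rewrite /dot !Cre_sum -big_split; apply: eq_bigr => i _ /=; ring]
    |rewrite (_ : (fun s => _) = fun s => Cim (dot (x s) (z s)) + Cim (dot (y s) (z s)));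
      [by apply: has_sumD; exact: l2_ip_im
      |by apply: funext => s; rewrite /dot !Cim_sum -big_split; apply: eq_bigr => i _ /=; ring]]).
- abstract (move=> a x y;
    have e s : dot ((l2_scale a x : l2vec) s) (y s) = (a * dot (x s) (y s))%C;
    [by rewrite /dot Cmul_suml; apply: eq_bigr => i _ /=; ring|];
    apply: l2_ip_eq => /=;
    [rewrite (_ : (fun s => _) = fun s => Cre a * Cre (dot (x s) (y s)) + (- Cim a) * Cim (dot (x s) (y s)));
      [rewrite (_ : Cre a * _ - _ = Cre a * Cre (l2_ip x y) + (- Cim a) * Cim (l2_ip x y));
        [by apply: has_sumD; apply: has_sumZ; [exact: l2_ip_re|exact: l2_ip_im]|by rewrite /=; ring]
      |by apply: funext => s; rewrite e /=; ring]
    |rewrite (_ : (fun s => _) = fun s => Cre a * Cim (dot (x s) (y s)) + Cim a * Cre (dot (x s) (y s)));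
      [by apply: has_sumD; apply: has_sumZ; [exact: l2_ip_im|exact: l2_ip_re]
      |by apply: funext => s; rewrite e /=; ring]]).
- abstract (move=> x y; apply: l2_ip_eq => /=;
    [rewrite (_ : (fun s => _) = fun s => Cre (dot (x s) (y s)));
      [exact: l2_ip_re|by apply: funext => s; rewrite (dot_conj (x s))]
    |rewrite (_ : (fun s => _) = fun s => (- (1)) * Cim (dot (x s) (y s)));
      [rewrite [X in has_sum _ X](_ : _ = (- (1)) * Cim (l2_ip x y));
        [by apply: has_sumZ; exact: l2_ip_im|by rewrite /=; ring]
      |by apply: funext => s; rewrite (dot_conj (x s)) /=; ring]]).
- abstract (move=> x; exact: has_sum_ge0 (fun s => sqnorm_ge0 _) (l2_sqnorm x)).
- abstract (move=> x x0; apply: l2_ext => s i; apply: Cabs2_eq0;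
    have := @Cabs2_le_sqnorm _ (x s) i; have := sqnorm_le_ip x s; have := Cabs2_ge0 (x s i);
    rewrite x0 /=; lra).
Defined.
End L2Sum.

(** * Norm and positivity through matrix-valued maps *)

Section BlockForms.
Variables (V : NormalMOStarOpSpace) (K : nat) (psi : V -> 'I_K -> 'I_K -> C).
Hypothesis psiP : ccp_block psi.
Local Notation mst := (mstar (@vstar V)).

Lemma fam_dot_actE n m (A : Mat V n m) y x :
  fam_dot (block_act psi A y) x
  = \csum_a \csum_b \csum_i \csum_j (psi (A a b) i j * y b j * Cconj (x a i)).
Proof.
apply: eq_bigr => a _; rewrite exchange_big; apply: eq_bigr => i _.
rewrite Cmul_sumr; apply: eq_bigr => b _; rewrite Cmul_sumr.
by apply: eq_bigr => j _.
Qed.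

Lemma fam_dot_act_linear n m y x :
  clinear (fun A : matCV V n m => fam_dot (block_act psi (A : Mat V n m) y) x).
Proof.
split=> [A B|c A]; rewrite !fam_dot_actE.
  do 4! (rewrite -big_split; apply: eq_bigr => ? _).
  by rewrite /= (proj1 (block_lin psiP _ _)); ring.
do 4! (rewrite Cmul_suml; apply: eq_bigr => ? _).
by rewrite /= (proj2 (block_lin psiP _ _)); ring.
Qed.

Lemma fam_dot_act_star n m (A : Mat V n m) x y :
  fam_dot (block_act psi (mst A) x) y = Cconj (fam_dot (block_act psi A y) x).
Proof.
rewrite !fam_dot_actE exchange_big Cconj_sum; apply: eq_bigr => a _.
rewrite Cconj_sum; apply: eq_bigr => b _.
rewrite exchange_big Cconj_sum; apply: eq_bigr => i _.
rewrite Cconj_sum; apply: eq_bigr => j _.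
by rewrite /mstar (block_star psiP) !Cconj_mul CconjK; ring.
Qed.

Lemma fam_dot_sa_im n (A : Mat V n n) x : mst A = A -> Cim (fam_dot (block_act psi A x) x) = 0.
Proof. by move=> sA; have := congr1 Cim (fam_dot_act_star A x x); rewrite sA /=; lra. Qed.

Lemma fam_sqnorm_ge0 n (x : 'I_n -> 'I_K -> C) : 0 <= fam_sqnorm x.
Proof. by apply: Rsum_ge0 => a _; exact: sqnorm_ge0. Qed.

Lemma fam_dot_amgm n (x y : 'I_n -> 'I_K -> C) s : 0 < s ->
  2 * Rabs (Cre (fam_dot x y)) <= s * fam_sqnorm x + / s * fam_sqnorm y.
Proof.
have key (z : 'I_n -> 'I_K -> C) : 0 < s -> 2 * Cre (fam_dot z y) <= s * fam_sqnorm z + / s * fam_sqnorm y.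
  move=> s0; rewrite /fam_dot /fam_sqnorm Cre_sum !Rmul_suml -big_split.
  by apply: Rsum_le => a _; exact: dot_amgm.
move=> s0; have h1 := key x s0.
have := key (fun a i => - (1) * x a i)%C s0.
have -> : fam_dot (fun a i => - (1) * x a i)%C y = (- (1) * fam_dot x y)%C.
  rewrite /fam_dot Cmul_suml; apply: eq_bigr => a _; rewrite Cmul_suml.
  by apply: eq_bigr => i _; ring.
have -> : fam_sqnorm (fun a i => - (1) * x a i)%C = fam_sqnorm x.
  apply: eq_bigr => a _; rewrite sqnormZ (_ : Cabs2 (- (1))%C = 1) ?Rmult_1_l //.
  by rewrite /Cabs2 /=; ring.
by rewrite /=; split_Rabs; lra.
Qed.
End BlockForms.

Section Criteria.
Variable V : NormalMOStarOpSpace.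
Local Notation mst := (mstar (@vstar V)).

(** No block can take A to a value <= - c < 0, so for every c > 0 there is a positive P with |A - P|
    <= c. Taking c = 1/(p + 1) gives a sequence in the cone that converges to A. *)
Lemma mcone_of_blocks n (A : Mat V n n) : mst A = A ->
  (forall K (psi : V -> 'I_K -> 'I_K -> C) e,
     ccp_block psi -> 0 <= Cre (fam_dot (block_act psi A e) e)) ->
  mcone A.
Proof.
move=> sA pos.
have approx (p : nat) : exists P : Mat V n n, mcone P /\
    mnorm (msub A P) <= / (INR p + 1).
  have p0 : 0 < / (INR p + 1).
    by apply: Rinv_0_lt_compat; have := pos_INR p; lra.
  have pc : pair_cone (pair_at A (/ (INR p + 1))).
    apply: contrapT => /exists_block[K [psi [e [psiP _ neg]]]].
    by have := pos K psi e psiP; lra.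
  have [Q [P [sQ PP Qle AE]]] := pair_cone_decomp sA p0 pc.
  exists P; split=> //; rewrite (_ : msub A P = Q) //.
  by apply: mat_ext => i j; rewrite AE /msub /madd /mopp; vlin.
have [u uP] := boolp.choice approx.
have [closed _] := nv_normal V n.
apply: (closed u) => [p|eps e0]; first by case: (uP p).
have [N [Nlt N0]] := archimed_cor1 eps e0.
exists N => p /leP Np; apply: Rle_lt_trans (proj2 (uP p)) _.
apply: Rle_lt_trans Nlt; apply: Rinv_le_contravar.
  by apply: lt_0_INR.
by have := le_INR _ _ Np; lra.
Qed.

Lemma mnorm_opp n m (A : Mat V n m) : mnorm (mopp A) = mnorm A.
Proof.
rewrite (_ : mopp A = mscale (RtoC (- (1))) A).
  have [_ [_ [-> _]]] := nv_norms V n m.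
  rewrite (_ : Cabs _ = 1) ?Rmult_1_l //.
  by rewrite /Cabs /Cabs2 /= (_ : _ + _ = 1) ?sqrt_1 //; ring.
by apply: mat_ext => i j; rewrite /mopp /mscale; vlin.
Qed.

Lemma mstar_opp n (A : Mat V n n) : mst A = A -> mst (mopp A) = mopp A.
Proof.
move=> sA; apply: mat_ext => i j; rewrite /mopp /mstar (starN (nv_starP V)).
by rewrite -{2}sA.
Qed.

Lemma norming_block n (A : Mat V n n) c : mst A = A -> 0 < c < mnorm A ->
  exists K (psi : V -> 'I_K -> 'I_K -> C) e,
    [/\ ccp_block psi, fam_sqnorm e <= 1 & c <= Rabs (Cre (fam_dot (block_act psi A e) e))].
Proof.
move=> sA [c0 cA]; have sN := mstar_opp sA.
case: (pselect (pair_cone (pair_at A c))) => [pc1|]; last first.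
  move=> /exists_block[K [psi [e [psiP e1 neg]]]]; exists K, psi, e.
  by split=> //; split_Rabs; lra.
case: (pselect (pair_cone (pair_at (mopp A) c))) => [pc2|]; last first.
  move=> /exists_block[K [psi [e [psiP e1 neg]]]]; exists K, psi, e.
  split=> //; move: neg; rewrite (clinearN _ (fam_dot_act_linear psiP e e)) /=.
  by split_Rabs; lra.
have [Q1 [P1 [sQ1 PP1 Q1le A1E]]] := pair_cone_decomp sA c0 pc1.
have [Q2 [P2 [sQ2 PP2 Q2le A2E]]] := pair_cone_decomp sN c0 pc2.
have [_ normal] := nv_normal V n.
have := normal Q1 A (mopp Q2) sQ1 sA (mstar_opp sQ2).
rewrite (_ : msub A Q1 = P1); last first.
  by apply: mat_ext => i j; rewrite A1E /msub /madd /mopp; vlin.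
rewrite (_ : msub (mopp Q2) A = P2); last first.
  apply: mat_ext => i j; move/(congr1 (fun M : Mat V n n => M i j)): A2E.
  by rewrite /msub /madd /mopp => ->; vlin.
move=> /(_ PP1 PP2); rewrite mnorm_opp.
by have := Rmax_lub _ _ _ Q1le Q2le; lra.
Qed.

Definition offdiag n m (A : Mat V n m) : Mat V (n + m) (n + m) := fun i j =>
  match split i, split j with
  | inl i', inr j' => A i' j'
  | inr i', inl j' => vstar (A j' i')
  | _, _ => 0v
  end.

Lemma offdiag_sa n m (A : Mat V n m) : mst (offdiag A) = offdiag A.
Proof.
apply: mat_ext => i j; rewrite /mstar /offdiag.
by case: (split i) => a; case: (split j) => b; rewrite ?(star0 (nv_starP V)) ?(starK (nv_starP V)).
Qed.

(** A is a corner of the large matrix, cut out by two isometries. *)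
Lemma mnorm_offdiag n m (A : Mat V n m) : mnorm A <= mnorm (offdiag A).
Proof.
pose X : Mat C (n + m) n := stack (cid_mx n) (fun _ _ => C0).
pose Y : Mat C (n + m) m := stack (fun _ _ => C0) (cid_mx m).
have sqnorm0 k l (v : 'I_l -> C) : sqnorm (cmatvec ((fun _ _ => C0) : Mat C k l) v) = 0.
  rewrite /sqnorm big1 // => i _; rewrite /cmatvec /Csum big1 => [|j _]; last by ring.
  by rewrite /Cabs2 /=; ring.
have AE : A = smul (cadj X) (offdiag A) Y.
  rewrite -[LHS]smul_cid_mx -{1}cadj_cid_mx; apply: mat_ext => i j.
  rewrite /smul /vsum big_split_ord /= [X in _ = _ +v X]big1 ?vadd0; last first.
    move=> p _; rewrite big1 // => q _.
    by rewrite /cadj /X /stack split_rshiftE (_ : Cmul _ _ = C0) ?vscale0 //; ceq.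
  apply: eq_bigr => p _; rewrite big_split_ord /= [X in _ = X +v _]big1 ?vadd0l; last first.
    by move=> q _; rewrite /offdiag !split_lshiftE vscaler0.
  apply: eq_bigr => q _.
  by rewrite /cadj /X /Y /stack /offdiag split_lshiftE split_rshiftE.
rewrite {1}AE; apply: Rle_trans (ruan_bound (c := 1) (d := 1) _ _ _ _ _) _; try lra.
  rewrite Rmult_1_l; apply: cadj_bound; first lra.
  by move=> v; rewrite sqnorm_stack sqnorm0 cmatvec_cid_mx; lra.
by move=> v; rewrite sqnorm_stack sqnorm0 cmatvec_cid_mx; lra.
Qed.

(** The two corners contribute complex conjugate values. The factor 2 matches the one on the left of
    [fam_dot_amgm]. *)
Lemma fam_dot_offdiag K (psi : V -> 'I_K -> 'I_K -> C) n m (A : Mat V n m) e :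
  ccp_block psi ->
  Cre (fam_dot (block_act psi (offdiag A) e) e) =
  2 * Cre (fam_dot (block_act psi A (fun b => e (rshift n b))) (fun a => e (lshift m a))).
Proof.
move=> psiP; set e1 := fun a => e (lshift m a); set e2 := fun b => e (rshift n b).
have psi0 i j : psi 0v i j = C0 := clinear0 (block_lin psiP i j).
suff -> : fam_dot (block_act psi (offdiag A) e) e
    = (fam_dot (block_act psi A e2) e1 + fam_dot (block_act psi (mst A) e1) e2)%C.
  by rewrite (fam_dot_act_star psiP) /=; ring.
rewrite {1}/fam_dot big_split_ord; congr Cadd; apply: eq_bigr => a _;
  apply: eq_bigr => i _; congr Cmul; rewrite /block_act big_split_ord /=.
  rewrite big1 => [|b _]; last first.
    rewrite big1 // => j _; rewrite /offdiag !split_lshiftE psi0; ring.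
  rewrite Cadd0l; apply: eq_bigr => b _; apply: eq_bigr => j _.
  by rewrite /offdiag split_lshiftE split_rshiftE.
rewrite [X in (_ + X)%C]big1 => [|b _]; last first.
  rewrite big1 // => j _; rewrite /offdiag !split_rshiftE psi0; ring.
rewrite CaddC Cadd0l; apply: eq_bigr => b _; apply: eq_bigr => j _.
by rewrite /offdiag split_lshiftE split_rshiftE.
Qed.

Lemma fam_sqnorm_split K n m (e : 'I_(n + m) -> 'I_K -> C) :
  fam_sqnorm e = fam_sqnorm (fun a => e (lshift m a)) + fam_sqnorm (fun b => e (rshift n b)).
Proof. by rewrite /fam_sqnorm big_split_ord. Qed.

Lemma mnorm_le_of_blocks n m (A : Mat V n m) M : 0 <= M ->
  (forall K (psi : V -> 'I_K -> 'I_K -> C) e,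
     ccp_block psi -> fam_sqnorm (block_act psi A e) <= M * M * fam_sqnorm e) ->
  mnorm A <= M.
Proof.
move=> M0 h; apply: Rnot_lt_le => MA.
(* These satisfy M < L < c < |A|. A norming block reaches [c], while weight 1/L bounds the same
   value by [L]; [L] is needed besides [M] because [M] may be 0. *)
pose L := (2 * M + mnorm A) / 3; pose c := (M + 2 * mnorm A) / 3.
have c0 : 0 < c < mnorm (offdiag A).
  by have := mnorm_offdiag A; rewrite /c; lra.
have [K [psi [e [psiP e1 ce]]]] := norming_block (offdiag_sa A) c0.
move: ce; rewrite fam_dot_offdiag // Rabs_mult Rabs_pos_eq; last lra.
set y := fun b => e (rshift n b); set x := fun a => e (lshift m a).
have L0 : 0 < L by rewrite /L; lra.
have Li : 0 < / L by apply: Rinv_0_lt_compat.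
have := fam_dot_amgm (block_act psi A y) x Li; rewrite Rinv_inv.
have hy := h K psi y psiP.
have y0 := fam_sqnorm_ge0 y; have x0 := fam_sqnorm_ge0 x.
have ML0 : M <= L by rewrite /L; lra.
have ML : M * M * fam_sqnorm y <= L * L * fam_sqnorm y.
  by apply: Rmult_le_compat_r => //; nra.
have h1 : / L * fam_sqnorm (block_act psi A y) <= L * fam_sqnorm y.
  apply: (Rmult_le_reg_l L) => //; rewrite -Rmult_assoc Rinv_r; lra.
have e1' : fam_sqnorm x + fam_sqnorm y <= 1 by rewrite -fam_sqnorm_split.
have h2 : L * (fam_sqnorm x + fam_sqnorm y) <= L * 1 by apply: Rmult_le_compat_l; lra.
by rewrite /c /L in L0 h1 h2 *; lra.
Qed.
End Criteria.

(** * The direct sum representation *)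

Section DirectSum.
Variable V : NormalMOStarOpSpace.
Local Notation mst := (mstar (@vstar V)).

Record block := Block {
  block_dim : nat;
  block_map : V -> 'I_block_dim -> 'I_block_dim -> C;
  block_ccp : ccp_block block_map
}.

(** Classical boolean equality of blocks, needed for duplicate-free finite index lists and for
    vectors supported on one block. *)
Let S : eqType := {classic block}.
Let K : S -> nat := block_dim.
Let psi (s : S) : V -> 'I_(K s) -> 'I_(K s) -> C := @block_map s.
Arguments psi : clear implicits.
Let H := l2Hilbert K.
Let psiP (s : S) : ccp_block (psi s) := block_ccp s.

Let rep_subproof (v : V) (x : l2vec K) :
  exists t, has_sum (fun s => sqnorm (fun i => \csum_j (psi s v i j * x s j))) t.
Proof.
have [t ht] := l2P x; pose A : Mat V 1 1 := fun _ _ => v.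
apply: has_sum_ex_le (has_sumZ (mnorm A * mnorm A) ht) => s.
split; first exact: sqnorm_ge0.
have := block_bound (psiP s) A (fun=> x s).
by rewrite /fam_sqnorm !big_ord1 /block_act; under eq_fun do rewrite big_ord1.
Qed.

Definition rep (v : V) (x : H) : H := L2Vec (rep_subproof v x).

Lemma l2_sumE m (F : 'I_m -> l2CV K) s i :
  (\vsum_b F b : l2vec K) s i = \csum_b (F b : l2vec K) s i.
Proof. by apply: (big_morph (fun x : l2CV K => (x : l2vec K) s i)). Qed.

Lemma ampl_repE n m (A : Mat V n m) (x : 'I_m -> l2vec K) a s :
  (ampl (H := H) rep A x a : l2vec K) s = block_act (psi s) A (fun b => x b s) a.
Proof. by apply: funext => i; rewrite /ampl /vsum l2_sumE. Qed.

Lemma has_sum_fam_sqnorm n (x : 'I_n -> l2vec K) :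
  has_sum (fun s => fam_sqnorm (fun a => x a s)) (Rsum (fun a => Cre (ip (x a : H) (x a)))).
Proof. by apply: has_sum_big => a; exact: l2_sqnorm. Qed.

Lemma has_sum_fam_dot_re n (x y : 'I_n -> l2vec K) :
  has_sum (fun s => Cre (fam_dot (fun a => x a s) (fun a => y a s)))
          (Cre (hvip (H := H) x y)).
Proof.
rewrite /hvip /Csum Cre_sum.
under eq_fun do rewrite /fam_dot Cre_sum.
by apply: has_sum_big => a; exact: l2_ip_re.
Qed.

Lemma has_sum_fam_dot_im n (x y : 'I_n -> l2vec K) :
  has_sum (fun s => Cim (fam_dot (fun a => x a s) (fun a => y a s)))
          (Cim (hvip (H := H) x y)).
Proof.
rewrite /hvip /Csum Cim_sum.
under eq_fun do rewrite /fam_dot Cim_sum.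
by apply: has_sum_big => a; exact: l2_ip_im.
Qed.

Lemma ampl_rep_dot n (A : Mat V n n) (x : 'I_n -> l2vec K) s :
  fam_dot (fun a => (ampl (H := H) rep A x a : l2vec K) s) (fun a => x a s)
  = fam_dot (block_act (psi s) A (fun b => x b s)) (fun a => x a s).
Proof. by apply: eq_bigr => a _; rewrite ampl_repE. Qed.

Lemma ampl_rep_sqnorm n m (A : Mat V n m) (x : 'I_m -> l2vec K) s :
  fam_sqnorm (fun a => (ampl (H := H) rep A x a : l2vec K) s)
  = fam_sqnorm (block_act (psi s) A (fun b => x b s)).
Proof. by apply: eq_bigr => a _; rewrite ampl_repE. Qed.

Lemma ampl_rep_bound n m (A : Mat V n m) (x : 'I_m -> H) :
  hvnorm (ampl rep A x) <= mnorm A * hvnorm x.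
Proof.
have A0 := mnorm_ge0 A.
rewrite /hvnorm -{1}(sqrt_square (mnorm A)) // -sqrt_mult_alt; last by nra.
apply: sqrt_le_1_alt.
apply: has_sum_le (has_sum_fam_sqnorm _) (has_sumZ _ (has_sum_fam_sqnorm x)) => s.
by rewrite ampl_rep_sqnorm; exact: (block_bound (psiP s)).
Qed.

(** The entries are indexed by natural numbers, so nothing has to be transported along s = s0;
    [l2_single] extends a vector by 0 to this form. *)
Let single_vec (s0 : S) (f : nat -> C) s (i : 'I_(K s)) : C :=
  if s == s0 then f i else C0.

Let single_subproof s0 f :
  exists t, has_sum (fun s => sqnorm (@single_vec s0 f s)) t.
Proof.
exists (sqnorm (@single_vec s0 f s0)).
apply: (@has_sum_single _ (fun s => sqnorm (@single_vec s0 f s))) => s /negbTE ss0.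
by rewrite /sqnorm big1 // => i _; rewrite /single_vec ss0 /Cabs2 /=; ring.
Qed.

Definition l2_single (s0 : S) (e : 'I_(K s0) -> C) : l2vec K :=
  L2Vec (single_subproof s0 (fun k => oapp e C0 (insub k))).

Lemma l2_single_same s0 (e : 'I_(K s0) -> C) : l2_single e s0 = e.
Proof. by apply: funext => i; rewrite /= /single_vec eqxx valK. Qed.

Lemma l2_single_other s0 (e : 'I_(K s0) -> C) s : s != s0 ->
  l2_single e s = fun=> C0.
Proof. by move=> /negbTE ss0; apply: funext => i; rewrite /= /single_vec ss0. Qed.

Lemma fam_dot_zero n k (x : 'I_n -> 'I_k -> C) : fam_dot x (fun _ _ => C0) = C0.
Proof.
by rewrite /fam_dot big1 // => a _; rewrite /dot big1 // => i _; ceq.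
Qed.

Lemma hvip_single n (A : Mat V n n) s0 (e : 'I_n -> 'I_(K s0) -> C) :
  let x : 'I_n -> H := fun a => l2_single (e a) in
  hvip (ampl rep A x) x = fam_dot (block_act (psi s0) A e) e.
Proof.
move=> x; pose G s := fam_dot (block_act (psi s) A (fun b => (x b : l2vec K) s)) (fun a => (x a : l2vec K) s).
have G0 : G s0 = fam_dot (block_act (psi s0) A e) e.
  rewrite /G (_ : (fun b => (x b : l2vec K) s0) = e) //.
  by apply: funext => b; rewrite l2_single_same.
have Gs s : s != s0 -> G s = C0.
  move=> ss0; rewrite /G (_ : (fun b => (x b : l2vec K) s) = fun _ _ => C0).
    exact: fam_dot_zero.
  by apply: funext => b; rewrite l2_single_other.
rewrite -G0; apply: C_ext.
  apply: has_sum_unique (has_sum_fam_dot_re _ x) _.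
  under eq_fun do rewrite ampl_rep_dot.
  by apply: (@has_sum_single _ (fun s => Cre (G s))) => s /Gs ->.
apply: has_sum_unique (has_sum_fam_dot_im _ x) _.
under eq_fun do rewrite ampl_rep_dot.
by apply: (@has_sum_single _ (fun s => Cim (G s))) => s /Gs ->.
Qed.

Lemma ip_single s0 (e : 'I_(K s0) -> C) : Cre (ip (l2_single e : H) (l2_single e)) = sqnorm e.
Proof.
apply: has_sum_unique (l2_sqnorm _) _; rewrite -{2}(l2_single_same e).
apply: (@has_sum_single _ (fun s => sqnorm (l2_single e s))) => s ss0.
by rewrite l2_single_other // /sqnorm big1 // => i _; rewrite /Cabs2 /=; ring.
Qed.

(** Normalised and placed in the summand [s0], a nonzero [e] is a unit vector of H^m, and one
    summand of the image is at most its whole norm. For e = 0 the bound of the block itself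
    suffices. *)
Lemma fam_sqnorm_act_le n m (A : Mat V n m) M s0 (e : 'I_m -> 'I_(K s0) -> C) : 0 <= M ->
  (forall x : 'I_m -> H, hvnorm x <= 1 -> hvnorm (ampl rep A x) <= M) ->
  fam_sqnorm (block_act (psi s0) A e) <= M * M * fam_sqnorm e.
Proof.
move=> M0 h; have bb := block_bound (psiP s0) A e.
have ge0 := fam_sqnorm_ge0 (block_act (psi s0) A e).
have [e0|e0] : 0 < fam_sqnorm e \/ fam_sqnorm e = 0 by have := fam_sqnorm_ge0 e; lra.
  have r0 : 0 < sqrt (fam_sqnorm e) by apply: sqrt_lt_R0.
  have rr : sqrt (fam_sqnorm e) * sqrt (fam_sqnorm e) = fam_sqnorm e by rewrite sqrt_sqrt; lra.
  set r := sqrt (fam_sqnorm e) in r0 rr.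
  have c2 : Cabs2 (RtoC (/ r)) * fam_sqnorm e = 1.
    by rewrite /Cabs2 /= -rr; field; lra.
  pose f a i := (RtoC (/ r) * e a i)%C.
  have nf : fam_sqnorm f = 1 by rewrite -c2 /fam_sqnorm Rmul_suml; apply: eq_bigr => a _; rewrite sqnormZ.
  pose x : 'I_m -> H := fun a => l2_single (f a).
  have x1 : hvnorm x <= 1.
    rewrite /hvnorm (_ : Rsum _ = 1) ?sqrt_1; first lra.
    by rewrite -nf; apply: eq_bigr => a _; exact: ip_single.
  have := h x x1; rewrite /hvnorm => hM.
  have le : fam_sqnorm (block_act (psi s0) A f) <= M * M.
    rewrite (_ : f = fun b => (x b : l2vec K) s0); last first.
      by apply: funext => b; rewrite l2_single_same.
    rewrite -ampl_rep_sqnorm.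
    have := has_sum_ge_psum (l := [:: s0]) (fun s => fam_sqnorm_ge0 _) (has_sum_fam_sqnorm (ampl (H := H) rep A x)) isT.
    rewrite /psum big_seq1 => /Rle_trans; apply.
    rewrite -[X in X <= _]sqrt_sqrt; last first.
      apply: Rsum_ge0 => a _; exact: ip_pos.
    by apply: Rmult_le_compat => //; exact: sqrt_pos.
  have eb : fam_sqnorm (block_act (psi s0) A f) = Cabs2 (RtoC (/ r)) * fam_sqnorm (block_act (psi s0) A e).
    rewrite /fam_sqnorm Rmul_suml; apply: eq_bigr => a _; rewrite -sqnormZ; congr sqnorm.
    apply: funext => i; rewrite /block_act Cmul_suml; apply: eq_bigr => b _.
    by rewrite Cmul_suml; apply: eq_bigr => j _; rewrite /f; ring.
  have := Rmult_le_compat_r _ _ _ (Rlt_le _ _ e0) le.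
  rewrite eb => hr; rewrite -[fam_sqnorm (block_act _ _ _)]Rmult_1_l -c2.
  by lra.
by rewrite e0 in bb *; lra.
Qed.

Lemma rep_norm n m (A : Mat V n m) : is_ampl_opnorm (H := H) rep A (mnorm A).
Proof.
split.
  move=> _ [x [x1 ->]]; apply: Rle_trans (ampl_rep_bound A x) _.
  by have := mnorm_ge0 A; nra.
move=> M hM.
have h (x : 'I_m -> H) : hvnorm x <= 1 -> hvnorm (ampl rep A x) <= M.
  by move=> x1; apply: hM; exists x.
(* The zero vector is an admissible test vector, whatever n and m are. *)
have M0 : 0 <= M.
  apply: Rle_trans (h (fun=> vzero) _); first exact: sqrt_pos.
  rewrite /hvnorm /Rsum big1 ?sqrt_0 => [|a _]; first lra.
  by rewrite -(vscale0 (vzero : H)) ip_scalel /=; ring.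
apply: mnorm_le_of_blocks => // k ps e psP.
exact: (@fam_sqnorm_act_le n m A M (Block psP) e M0 h).
Qed.

Lemma rep_pos n (A : Mat V n n) : op_pos (H := H) (ampl rep A) <-> mcone A.
Proof.
split=> [pos|cA x].
  have blk_pos k (ps : V -> 'I_k -> 'I_k -> C) e : ccp_block ps ->
      Cim (fam_dot (block_act ps A e) e) = 0 /\ 0 <= Cre (fam_dot (block_act ps A e) e).
    by move=> psP; have := pos (fun a => l2_single (s0 := Block psP) (e a)); rewrite hvip_single.
  apply: mcone_of_blocks => [|k ps e psP]; last by case: (blk_pos k ps e psP).
  (* Self-adjointness of A has to be recovered first. D = i A - i A^* is self-adjoint, and each
     block takes it to - 2 Im <psi(A) e, e> = 0; as blocks detect norms of self-adjoint matrices, D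
     = 0. *)
  pose D : matCV V n n := Ci *v ((A : matCV V n n) +v (- (1)) *r (mst A : matCV V n n)).
  have sD : mst D = D.
    apply: mat_ext => i j; rewrite /D /mstar /= !(starZ (nv_starP V), starD (nv_starP V), starK (nv_starP V)).
    by rewrite Cconj_RtoC; vlin.
  have D0 : mnorm (D : Mat V n n) = 0.
    apply: contrapT => Dn0.
    have c0 : 0 < mnorm (D : Mat V n n) / 2 < mnorm (D : Mat V n n).
      by have := mnorm_ge0 (D : Mat V n n); lra.
    have [k [ps [e [psP _ ce]]]] := norming_block sD c0.
    have [im _] := blk_pos k ps e psP.
    have [lD lZ] := fam_dot_act_linear psP (n := n) (m := n) e e.
    have z : Cre (fam_dot (block_act ps (D : Mat V n n) e) e) = 0.
      by rewrite /D lZ lD lZ (fam_dot_act_star psP) /= im; ring.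
    by rewrite z Rabs_R0 in ce; lra.
  have DE := mnorm_eq0 D0; apply: mat_ext => i j.
  have : D i j = 0v by rewrite DE.
  rewrite /D /= => e.
  rewrite (_ : A i j = mst A i j +v (- Ci)%C *v (Ci *v (A i j +v (- (1)) *r mst A i j))); last by vlin.
  by rewrite e; vlin.
have im0 : has_sum (fun s : S => Cim (fam_dot (fun a => (ampl (H := H) rep A x a : l2vec K) s)
    (fun a => (x a : l2vec K) s))) 0.
  rewrite (_ : (fun s => _) = (fun=> 0)); first exact: has_sum0.
  by apply: funext => s; rewrite ampl_rep_dot (fam_dot_sa_im (psiP s)) // mcone_sa.
split; first exact: has_sum_unique (has_sum_fam_dot_im _ _) im0.
apply: has_sum_ge0 (has_sum_fam_dot_re _ _) => s.
by rewrite ampl_rep_dot; exact: (block_pos (psiP s)).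
Qed.

Lemma rep_bounded_linear v : bounded_linear (rep v).
Proof.
split; [|split] => [x y|a x|].
- apply: l2_ext => s i /=; rewrite -big_split; apply: eq_bigr => j _ /=; ring.
- apply: l2_ext => s i /=; rewrite Cmul_suml; apply: eq_bigr => j _; ring.
exists (mnorm (fun _ _ : 'I_1 => v)) => x.
have := ampl_rep_bound (fun _ _ : 'I_1 => v) (fun=> x).
by rewrite /hvnorm /Rsum !big_ord1 /ampl /vsum big_ord1.
Qed.

Lemma repD v w x : rep (v +v w) x = rep v x +v rep w x.
Proof.
apply: l2_ext => s i /=; rewrite -big_split; apply: eq_bigr => j _ /=.
by rewrite (proj1 (block_lin (psiP s) i j)); ring.
Qed.

Lemma repZ a v x : rep (a *v v) x = a *v rep v x.
Proof.
apply: l2_ext => s i /=; rewrite Cmul_suml; apply: eq_bigr => j _ /=.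
by rewrite (proj2 (block_lin (psiP s) i j)); ring.
Qed.
End DirectSum.

Theorem theorem3p2 (V : NormalMOStarOpSpace) :
  exists (H : HilbertSpace) (phi : V -> H -> H),
    (forall v w x, phi (vadd v w) x = vadd (phi v x) (phi w x)) /\
    (forall a v x, phi (vscale a v) x = vscale a (phi v x)) /\
    (forall v, bounded_linear (phi v)) /\
    (forall n m (A : Mat V n m), is_ampl_opnorm phi A (mnorm A)) /\
    (forall n (A : Mat V n n), op_pos (ampl phi A) <-> mcone A).
Proof.
exists (l2Hilbert (S := {classic block V}) (@block_dim V)), (@rep V).
split; first exact: repD.
split; first exact: repZ.
split; first exact: rep_bounded_linear.
by split=> *; [exact: rep_norm|exact: rep_pos].
Qed.
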